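(* Let $P=[p_{i,j}]$ be the transition matrix of an irreducible and aperiodic $M$-state Markov chain and let $\beta>0$. For each $N$ let $(x_s)_{s\in\{1,\dots,M\}^N}$ be i.i.d. $\mathcal{N}(0,N)$ random variables. Then the free energy density $$\widetilde\varphi(\beta)=\lim_{N\to\infty}\frac1N\,\mathbb{E}\log\Big(\sum_{s\in\{1,\dots,M\}^N}P(s)\exp(\beta x_s)\Big)$$ exists and is given by $$\widetilde\varphi(\beta)=\sup_{\rho,\xi\in\mathbb{R}}\{s(\rho,\xi)+\beta\xi+\rho\},$$ where $$s(\rho,\xi)=\begin{cases}s(\rho)-\frac{\xi^2}{2},&\text{if }|\xi|\le\sqrt{2s(\rho)},\\-\infty,&\text{otherwise,}\end{cases}\qquad s(\rho)=\inf_{t\in\mathbb{R}}\{\log\lambda_t-t\rho\}.$$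
   Context: $\pi$ is the stationary distribution of $P$; for a path $s=(s_1,\dots,s_N)\in\{1,\dots,M\}^N$, $P(s)=\pi_{s_1}p_{s_1,s_2}\cdots p_{s_{N-1},s_N}$. $\lambda_t=\lambda_{\max}(P^{(t)})$ is the Perron-Frobenius eigenvalue of the matrix $P^{(t)}$ with entries $p_{i,j}^t$ if $p_{i,j}\ne0$ and $0$ otherwise. The function $s(\rho)$ takes values in $[0,\infty)\cup\{-\infty\}$; where $s(\rho)=-\infty$, one sets $s(\rho,\xi)=-\infty$ for all $\xi$. (The symbol $s$ with real arguments is a function; as an index it is a path.) *)

(* Defs.v *)
From HB Require Import structures.
From mathcomp Require Import all_boot all_order all_algebra.
From mathcomp Require Import complex.
From mathcomp Require Import all_classical all_reals all_analysis.

Set Implicit Arguments.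
Unset Strict Implicit.
Unset Printing Implicit Defensive.

Import Order.TTheory GRing.Theory Num.Theory.
Import numFieldNormedType.Exports.

Local Open Scope classical_set_scope.
Local Open Scope ring_scope.

Section MarkovChain.
Context {R : realType} {M : nat}.
Implicit Types (P : 'M[R]_M) (pi : 'rV[R]_M).

Definition stochastic P :=
  (forall i j, 0 <= P i j) /\ (forall i, \sum_j P i j = 1).

Definition irreducible P := forall i j, exists n : nat, 0 < (P ^+ n) i j.

(* For every state i, the only common divisor of the possible return times
   { n >= 1 | (P ^+ n) i i > 0 } is 1, i.e., their gcd is 1. *)
Definition aperiodic P := forall (i : 'I_M) (d : nat),
  (forall n : nat, (0 < n)%N -> 0 < (P ^+ n) i i -> (d %| n)%N) -> d = 1%N.

Definition stationary pi P :=
  [/\ forall i, 0 <= pi 0 i, \sum_i pi 0 i = 1 & pi *m P = pi].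

(* pi_{s_1} p_{s_1,s_2} ... p_{s_{N-1},s_N}; the empty path is a junk case. *)
Definition path_prob pi P (s : seq 'I_M) : R :=
  if s is i :: s' then
    pi 0 i * \prod_(q <- pairmap (fun j k => P j k) i s') q
  else 1.

(* The entry 0 is treated apart because 0 `^ 0 = 1. *)
Definition mx_powR P (t : R) : 'M[R]_M :=
  \matrix_(i, j) (if P i j == 0 then 0 else P i j `^ t).

(* a is an eigenvalue of A whose value is at least the modulus of every
   complex eigenvalue of A; there is at most one such a. *)
Definition is_PF_eigenvalue (A : 'M[R]_M) (a : R) :=
  eigenvalue A a /\
  forall z : R[i], eigenvalue (map_mx (real_complex R) A) z ->
    `|z| <= real_complex R a.

Definition lambda_max (A : 'M[R]_M) : R := xget 0 [set a | is_PF_eigenvalue A a].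

Definition entropy P (rho : R) : \bar R :=
  ereal_inf [set (ln (lambda_max (mx_powR P t)) - t * rho)%:E | t in [set: R]].

(* entropy P rho is never +oo, being an infimum of reals, so that the default
   branch is the case entropy P rho = -oo. *)
Definition entropy2 P (rho xi : R) : \bar R :=
  if entropy P rho is r%:E then
    if `|xi| <= Num.sqrt (2 * r) then (r - xi ^+ 2 / 2)%:E else -oo%E
  else -oo%E.

Definition partition_function pi P (N : nat) (beta : R)
    (x : N.-tuple 'I_M -> R) : R :=
  \sum_(s : N.-tuple 'I_M) path_prob pi P s * expR (beta * x s).

End MarkovChain.

Section Gaussian.
Context {R : realType} {d : measure_display} {T : measurableType d}.
Variable Pr : probability T R.

Definition mutually_independent (I : finType) (X : I -> {RV Pr >-> R}) :=
  forall (J : {set I}) (B : I -> set R), (forall i, measurable (B i)) ->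
    Pr (\bigcap_(i in [set i | i \in J]) (X i @^-1` B i)) =
    \big[*%E/1%E]_(i in J) Pr (X i @^-1` B i).

(* The second parameter of normal_prob is the standard deviation. *)
Definition iid_normal (I : finType) (v : R) (X : I -> {RV Pr >-> R}) :=
  mutually_independent X /\
  forall i (B : set R), measurable B ->
    distribution Pr (X i) B = normal_prob 0 (Num.sqrt v) B.

End Gaussian.

(* Main.v *)
From HB Require Import structures.
Require Import Defs.
From mathcomp Require Import all_boot all_order all_algebra.
From mathcomp Require Import complex ring lra.
From mathcomp Require Import all_classical all_reals all_analysis.
From mathcomp Require Import measurable_realfun.
Import Order.TTheory GRing.Theory Num.Theory.
Import numFieldNormedType.Exports.
Local Open Scope classical_set_scope.
Local Open Scope ring_scope.
Set Implicit Arguments.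
Unset Strict Implicit.
Unset Printing Implicit Defensive.

(* Write h(u) = log lambda_u + u^2 beta^2 / 2 and
   Z_u = sum_s (P(s) exp (beta x_s))^u, so that (1/N) log E Z_u -> h(u).

   Upper bound: for 0 < u <= 1, Z_1 <= Z_u^(1/u), and Jensen's inequality gives
   limsup (1/N) E log Z_1 <= h(u) / u.

   Lower bound: as long as h(u)/u decreases at u, there is p in (1, 2] with
   h(p u) < p h(u), which says that the p-th moments of the summands of Z_u are
   negligible against (E Z_u)^p; a truncated second moment argument, which needs
   pairwise independence only, then gives (1/N) E log Z_u -> h(u).  Since
   u |-> E log Z_u is convex, this limit extends to a lower bound
   along tangents: at a minimizer th of h(u)/u on (0, 1], it reads h(th)/th.
   This requires log lambda_t to be differentiable, which comes from the
   solvability of the Poisson equation of the Markov chain tilted by the Perron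
   eigenvector.

   Finally inf_{0 < u <= 1} h(u)/u is the variational formula: weak duality is
   elementary, and the supremum is attained at rho = (log lambda)'(th) and
   xi = th beta. *)

(** * Perron-Frobenius theory *)

(** A plain second moment would need h(2u) < 2 h(u), which can fail while h(u)/u still decreases.
    Exponents p close to 1 reach the whole range: the derivative of h(pu) - p h(u) in p at p = 1 is
    u h'(u) - h(u), which has the sign of (h(u)/u)'. What makes p < 2 compatible with pairwise
    independence is truncation: for a summand a of Z_u / E Z_u, both min(a, 1)^2 and a - min(a, 1)
    are at most a^p, so one p-th moment controls the variance and the lost mean. On the exceptional
    event log Z_u is bounded below through one fixed path of probability at least M^-N. This costs a
    term linear in N, against an exponentially small probability.

    If the minimizer th is interior, h'(th) = h(th)/th: the tangent of h at th passes through the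
    origin and takes the value h(th)/th at 1, which is why the tangent bound matches the upper
    bound. If the infimum is only approached as u tends to 0, its value is at most 0, and Jensen's
    inequality over the paths gives the lower bound. *)

Lemma continuous_sumr (R : realType) (T : topologicalType) (I : finType)
    (f : I -> T -> R) :
  (forall i, continuous (f i)) -> continuous (fun q => \sum_i f i q).
Proof.
move=> cf q; elim: (index_enum I) => [|i s IH].
  rewrite /continuous_at big_nil; under eq_fun do rewrite big_nil;
    exact: cvg_cst.
rewrite /continuous_at big_cons; under eq_fun do rewrite big_cons.
by apply: cvgD => //; exact: cf.
Qed.

Section PerronFrobenius.
Context {R : realType} {M : nat}.
Implicit Types (A B : 'M[R]_M) (u : 'rV[R]_M) (v : 'cV[R]_M).

Definition nonneg_mx A := forall i j, 0 <= A i j.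

Lemma nonneg_mxX A n : nonneg_mx A -> nonneg_mx (A ^+ n).
Proof.
move=> A0; elim: n => [|n IH] i j; first by rewrite expr0 mxE; case: (i == j).
by rewrite exprSr mxE; apply: sumr_ge0 => k _; rewrite mulr_ge0.
Qed.

Lemma mulmx_gt0 m n p (A : 'M[R]_(m, n)) (B : 'M[R]_(n, p)) i j k :
  (forall i j, 0 <= A i j) -> (forall i j, 0 <= B i j) ->
  0 < A i k -> 0 < B k j -> 0 < (A *m B) i j.
Proof.
move=> A0 B0 Aik Bkj; rewrite mxE (bigD1 k)//= ltr_pwDl ?mulr_gt0//.
by apply: sumr_ge0 => l _; rewrite mulr_ge0.
Qed.

Lemma mulmx_gt0_ex m n p (A : 'M[R]_(m, n)) (B : 'M[R]_(n, p)) i j :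
  (forall i j, 0 <= A i j) -> (forall i j, 0 <= B i j) ->
  0 < (A *m B) i j -> exists2 k, 0 < A i k & 0 < B k j.
Proof.
move=> A0 B0; rewrite mxE => ABij.
have [/existsP[k /andP[]]|/existsPn h] :=
  boolP [exists k, (0 < A i k) && (0 < B k j)]; first by exists k.
move: ABij; rewrite big1 ?ltxx// => k _; apply/eqP.
have := h k; rewrite negb_and -!leNgt mulf_eq0 => /orP[] le0.
  by rewrite eq_le le0 A0.
by rewrite [B k j == 0]eq_le le0 B0 orbT.
Qed.

(** Irreducibility depends only on the positions of the positive entries, so it passes from [P] to
    its entrywise powers and to the tilted chain. *)
Lemma irreducible_sub A B : nonneg_mx A -> nonneg_mx B ->
  (forall i j, 0 < A i j -> 0 < B i j) -> irreducible A -> irreducible B.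
Proof.
move=> A0 B0 AB irrA i j; have [n Anij] := irrA i j; exists n.
elim: n j Anij => [//|n IH] j; rewrite !exprSr.
move=> /(mulmx_gt0_ex (nonneg_mxX n A0) A0)[k Aik Akj].
exact: (mulmx_gt0 (nonneg_mxX n B0) B0 (IH _ Aik) (AB _ _ Akj)).
Qed.

Lemma trmx_exprn A n : (A ^+ n)^T = A^T ^+ n.
Proof.
elim: n => [|n IH]; first by rewrite !expr0 -[1]/(1%:M) trmx1.
by rewrite exprSr exprS trmx_mul IH.
Qed.

Lemma irreducible_tr A : irreducible A -> irreducible A^T.
Proof.
by move=> irrA i j; have [n] := irrA j i; exists n; rewrite -trmx_exprn mxE.
Qed.

(* [B] plays the role of (1 + A)^K: it sends nonnegative nonzero vectors to
   positive ones, compatibly with the action of [A]. *)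
Lemma irreducible_commuting_pos A : nonneg_mx A -> irreducible A ->
  exists B : 'M[R]_M, [/\ forall i j, 0 < B i j, A *m B = B *m A &
    forall (u : 'rV[R]_M) r, u *m A = r *: u -> exists b, u *m B = b *: u].
Proof.
move=> A0 irrA; pose n i j := sval (cid (irrA i j)).
exists (\sum_i \sum_j A ^+ n i j); split=> [i j||u r uA].
- have ge0 k l : 0 <= (A ^+ n k l) i j by exact: nonneg_mxX.
  rewrite summxE (bigD1 i)//= summxE (bigD1 j)//= -addrA ltr_pwDl//.
    by rewrite /n; case: (cid _).
  by rewrite addr_ge0 ?sumr_ge0// => k _; rewrite summxE sumr_ge0.
- rewrite mulmx_sumr mulmx_suml; apply: eq_bigr => i _.
  rewrite mulmx_sumr mulmx_suml; apply: eq_bigr => j _.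
  by rewrite !mulmxE -exprS -exprSr.
- have uAn m : u *m A ^+ m = r ^+ m *: u.
    elim: m => [|m IH]; first by rewrite !expr0 mulmx1 scale1r.
    by rewrite !exprSr -mulmxE mulmxA IH -scalemxAl uA scalerA.
  exists (\sum_i \sum_j r ^+ n i j).
  rewrite mulmx_sumr scaler_suml; apply: eq_bigr => i _.
  by rewrite mulmx_sumr scaler_suml; apply: eq_bigr.
Qed.

(** The Collatz-Wielandt variational problem. Maximizing over pairs (vector, r) keeps the
    constraints jointly continuous, whereas the minimum of the ratios (u A)_j / u_j is not
    continuous where coordinates vanish. *)
Lemma exists_max_subinvariant A : (0 < M)%N -> nonneg_mx A ->
  exists r u, [/\ 0 <= r, forall j, 0 <= u 0 j, \sum_j u 0 j = 1,
    forall j, r * u 0 j <= (u *m A) 0 j &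
    forall s u', 0 <= s -> (forall j, 0 <= u' 0 j) -> \sum_j u' 0 j = 1 ->
      (forall j, s * u' 0 j <= (u' *m A) 0 j) -> s <= r].
Proof.
move=> M0 A0.
(* Summing r u_j <= (u A)_j over j, with coordinates of u at most 1, bounds r by the sum of all
   entries; this makes the domain compact. *)
pose C := \sum_i \sum_j A i j.
have C0 : 0 <= C by rewrite /C !sumr_ge0// => i _; rewrite sumr_ge0.
have le1 u : (forall j, 0 <= u 0 j) -> \sum_j u 0 j = 1 -> forall j, u 0 j <= 1.
  by move=> u0 <- j; rewrite (bigD1 j)//= lerDl sumr_ge0.
pose K := [set v : 'rV[R]_M | forall i, v ord0 i \in `[0, 1]] `*`
  `[0, C]%classic.
pose F := [set q : 'rV[R]_M * R | \sum_j q.1 0 j = 1] `&`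
  \bigcap_(j : 'I_M) [set q : 'rV[R]_M * R | 0 <= (q.1 *m A) 0 j - q.2 * q.1 0
    j].
have cK : compact K.
  have cB : compact [set v : 'rV[R]_M | forall i, v ord0 i \in `[0, 1]].
    refine (@rV_compact R _ (fun=> `[0, 1]%classic) _) => _;
      exact: segment_compact.
  exact: (compact_setX cB (@segment_compact R 0 C)).
have c1 j : continuous (fun q : 'rV[R]_M * R => q.1 0 j).
  move=> q; apply: (continuous_comp (f := fst) (g := fun u : 'rV[R]_M => u 0
    j)).
    exact: cvg_fst.
  exact: coord_continuous.
have cF : closed F.
  apply: closedI.
    apply: (closed_comp (f := fun q : 'rV[R]_M * R => \sum_j q.1 0 j) (D:=[set
      1])).
      move=> q _; exact: continuous_sumr.
    exact: closed_eq.
  apply: closed_bigI => j _.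
  apply: (closed_comp (f := fun q : 'rV[R]_M * R => (q.1 *m A) 0 j - q.2 * q.1
    0 j) (D:=[set x | 0 <= x])).
    move=> q _; apply: cvgB; last by apply: cvgM; [exact: cvg_snd|exact: c1].
    rewrite mxE.
    under eq_fun do rewrite mxE.
    apply: (continuous_sumr (f := fun k (q : 'rV[R]_M * R) => q.1 0 k * A k
      j)) => k p.
    by apply: cvgMl; exact: c1.
  exact: closed_ge.
have Fbd s u : 0 <= s -> (forall j, 0 <= u 0 j) -> \sum_j u 0 j = 1 ->
    (forall j, s * u 0 j <= (u *m A) 0 j) -> (K `&` F) (u, s).
  move=> s0 u0 u1 su; split; split => //=.
  - by move=> i; rewrite in_itv/= u0 le1.
  - rewrite in_itv/= s0 -[s]mulr1 -u1 mulr_sumr.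
    rewrite (le_trans (ler_sum _ (fun j _ => su j)))// /C exchange_big/=.
    apply: ler_sum => j _; rewrite mxE; apply: ler_sum => i _.
    by rewrite ler_piMl// le1.
  - by move=> j _ /=; rewrite subr_ge0.
have KF : K `&` F !=set0.
  exists (delta_mx 0 (Ordinal M0), 0); apply: Fbd => //.
  - by move=> j; rewrite mxE; case: (_ && _).
  - rewrite (bigD1 (Ordinal M0))//= mxE !eqxx big1 ?addr0// => j /negbTE jN.
    by rewrite mxE jN andbF.
  - move=> j; rewrite mul0r mxE sumr_ge0// => k _.
    by rewrite mulr_ge0// mxE; case: (_ && _).
have cKF : compact (K `&` F).
  by apply: (subclosed_compact _ cK) => //; apply: closedI => //;
    exact: compact_closed.
have : {within K `&` F, continuous (snd : 'rV[R]_M * R -> R)}.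
  by apply: continuous_subspaceT => q; exact: cvg_snd.
move=> /(compact_EVT_max KF cKF)[[u r]]; rewrite inE => -[[/= uK rK] [u1 /=
  uF]] maxr.
exists r, u; split => //.
- by move: rK; rewrite in_itv/= => /andP[].
- by move=> j; have := uK j; rewrite in_itv/= => /andP[].
- by move=> j; have := uF j I => /=; rewrite subr_ge0.
- by move=> s u' s0 u'0 u'1 su'; apply: (maxr (u', s)); rewrite inE; exact: Fbd.
Qed.

(** At a maximizer the subinvariance must be an equality: otherwise multiplying by [B] makes it
    strict in every coordinate, and r could be increased. Positivity of u then follows from u B = b
    u, whose left side is positive. *)
Lemma PF_row A : (0 < M)%N -> nonneg_mx A -> irreducible A ->
  exists a u, (forall j, 0 < u 0 j) /\ u *m A = a *: u.
Proof.
move=> M0 A0 irrA.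
have [r [u [r0 u0 u1 ru maxr]]] := exists_max_subinvariant M0 A0.
have [B [B0 AB uB]] := irreducible_commuting_pos A0 irrA.
have pos (y : 'rV[R]_M) : (forall j, 0 <= y 0 j) -> y != 0 ->
    forall j, 0 < (y *m B) 0 j.
  move=> y0 /rV0Pn[k yk] j.
  apply: (mulmx_gt0 (k := k)) => // [i l|i l|]; first by rewrite ord1.
    exact/ltW.
  by rewrite lt_def yk y0.
have subE (y z : 'rV[R]_M) b k : (y - b *: z) 0 k = y 0 k - b * z 0 k.
  by rewrite mxE; congr (_ + _); rewrite !mxE.
have uN0 : u != 0.
  by apply/eqP => uE; move: u1; rewrite uE big1 ?(eqP (oner_eq0 _))// =>
    [/esym/eqP|? _];
    rewrite ?oner_eq0// mxE.
have eqru : u *m A = r *: u.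
  apply/eqP; rewrite -subr_eq0; apply: contraT => N0.
  have y0 j : 0 < ((u *m A - r *: u) *m B) 0 j.
    by apply: pos => // k; rewrite subE subr_ge0.
  pose w := u *m B; have w0 j : 0 < w 0 j by exact: pos.
  have wA j : r * w 0 j < (w *m A) 0 j.
    by have := y0 j; rewrite mulmxBl -mulmxA AB mulmxA -scalemxAl subE subr_gt0.
  pose S := \sum_j w 0 j.
  have S0 : 0 < S by rewrite /S (bigD1 (Ordinal M0))//= ltr_pwDl// sumr_ge0//
    => j _; rewrite ltW.
  have [e e0 we] : exists2 e, 0 < e & forall j, (r + e) * w 0 j <= (w *m A) 0 j.
    (* The smallest relative gap; the cap at 1 is only the unit of the iterated minimum. *)
    pose e := \big[Order.min/1]_j (((w *m A) 0 j - r * w 0 j) / w 0 j).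
    exists e => [|j].
      by apply: lt_bigmin => // j _; rewrite divr_gt0// subr_gt0.
    by rewrite mulrDl -lerBrDl -ler_pdivlMr// bigmin_le_cond.
  have : r + e <= r.
    apply: (maxr _ (S^-1 *: w)).
    - by rewrite addr_ge0// ltW.
    - by move=> j; rewrite mxE mulr_ge0// ?invr_ge0 ltW.
    - by under eq_bigr do rewrite mxE; rewrite -mulr_sumr mulVf// gt_eqF.
    - by move=> j; rewrite -scalemxAl [leRHS]mxE [X in _ * X <= _]mxE mulrCA
      ler_pM2l ?invr_gt0 ?we.
  by rewrite gerDl leNgt e0.
exists r, u; split => // j; have [b ub] := uB _ _ eqru.
have := pos u u0 uN0 j; rewrite ub mxE => bu; rewrite lt_def u0 andbT.
by apply: contraTneq bu => ->; rewrite mulr0 ltxx.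
Qed.

Lemma PF_col A : (0 < M)%N -> nonneg_mx A -> irreducible A ->
  exists a v, (forall i, 0 < v i 0) /\ A *m v = a *: v.
Proof.
move=> M0 A0 irrA.
have A0' : nonneg_mx A^T by move=> i j; rewrite mxE.
have [a [u [u0 uA]]] := PF_row M0 A0' (irreducible_tr irrA).
exists a, u^T; split => [i|]; first by rewrite mxE.
by rewrite -{1}[A]trmxK -trmx_mul uA linearZ.
Qed.

Lemma mulmx_col_gt0 (u : 'rV[R]_M) v : (0 < M)%N -> (forall j, 0 < u 0 j) ->
  (forall i, 0 < v i 0) -> 0 < (u *m v) 0 0.
Proof.
by move=> M0 u0 v0; apply: (mulmx_gt0 (k := Ordinal M0)) => // i j;
  rewrite ord1 ltW.
Qed.

(* Pairing with a positive left eigenvector [u], an inequality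
   [A v <= c v] becomes [a (u v) <= c (u v)]. *)
Lemma row_eigen_le A a u v c : (0 < M)%N -> (forall j, 0 < u 0 j) ->
  u *m A = a *: u -> (forall i, 0 < v i 0) ->
  (forall i, (A *m v) i 0 <= c * v i 0) -> a <= c.
Proof.
move=> M0 u0 uA v0 Av.
rewrite -(ler_pM2r (mulmx_col_gt0 M0 u0 v0)).
have -> : a * (u *m v) 0 0 = (u *m (A *m v)) 0 0.
  by rewrite mulmxA uA -scalemxAl [RHS]mxE.
rewrite mxE [X in c * X]mxE mulr_sumr; apply: ler_sum => j _.
by rewrite mulrCA ler_pM2l.
Qed.

Lemma row_eigen_ge A a u v c : (0 < M)%N -> (forall j, 0 < u 0 j) ->
  u *m A = a *: u -> (forall i, 0 < v i 0) ->
  (forall i, c * v i 0 <= (A *m v) i 0) -> c <= a.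
Proof.
move=> M0 u0 uA v0 Av; rewrite -lerN2.
apply: (row_eigen_le (A := - A) M0 u0 _ v0) => [|i].
  by rewrite mulmxN uA scaleNr.
by rewrite mulNmx mxE mulNr lerN2.
Qed.

(** Taking moduli in w A = z w gives |z| |w| <= |w| A coordinatewise, and pairing with the positive
    right eigenvector [v] turns this into |z| <= a. *)
Lemma PF_eigenvalue_col A a u v : (0 < M)%N -> nonneg_mx A ->
  (forall j, 0 < u 0 j) -> u *m A = a *: u ->
  (forall i, 0 < v i 0) -> A *m v = a *: v -> is_PF_eigenvalue A a.
Proof.
move=> M0 A0 u0 uA v0 Av; split.
  apply/eigenvalueP; exists u => //; apply/rV0Pn.
  by exists (Ordinal M0); rewrite gt_eqF.
move=> z /eigenvalueP[w wA w0].
have Avi i : \sum_j A i j * v j 0 = a * v i 0.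
  by have := congr1 (fun y : 'cV_M => y i 0) Av; rewrite !mxE.
pose n j := complex.Re `|w 0 j|.
have nE j : `|w 0 j| = real_complex R (n j).
  by rewrite /n RRe_real// normr_real.
pose zn := complex.Re `|z|.
have znE : `|z| = real_complex R zn by rewrite /zn RRe_real// normr_real.
rewrite znE lecR.
have n0 j : 0 <= n j by rewrite -lecR -nE; exact: normr_ge0.
have nz j : zn * n j <= \sum_i n i * A i j.
  rewrite -lecR rmorphM/= -znE -nE -normrM.
  have -> : z * w 0 j = \sum_i w 0 i * (real_complex R (A i j)).
    have := congr1 (fun y : 'rV_M => y 0 j) wA; rewrite !mxE => <-.
    by apply: eq_bigr => i _; rewrite mxE.
  rewrite rmorph_sum/= (le_trans (ler_norm_sum _ _ _))//.
  apply: ler_sum => i _; rewrite normrM rmorphM/= -nE ler_wpM2l//.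
  by rewrite ger0_norm// lecR.
have S0 : 0 < \sum_j n j * v j 0.
  have [k wk] := rV0Pn _ w0.
  rewrite (bigD1 k)//= ltr_pwDl ?sumr_ge0// => [|j _]; last first.
    by rewrite mulr_ge0// ltW.
  by rewrite mulr_gt0// -ltcR -nE; rewrite -normr_gt0 in wk.
rewrite -(ler_pM2r S0) !mulr_sumr.
apply: (@le_trans _ _ (\sum_j \sum_i n i * A i j * v j 0)).
  apply: ler_sum => j _; rewrite mulrA -mulr_suml ler_wpM2r ?nz// ltW//.
rewrite exchange_big/=; apply: ler_sum => i _.
under eq_bigr do rewrite -mulrA.
by rewrite -mulr_sumr Avi mulrCA.
Qed.

Lemma is_PF_eigenvalue_unique A a b :
  is_PF_eigenvalue A a -> is_PF_eigenvalue A b -> a = b.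
Proof.
have le c d : is_PF_eigenvalue A c -> is_PF_eigenvalue A d -> c <= d.
  move=> [/eigenvalueP[u uA u0] _] [_ d_max].
  have /d_max : eigenvalue (map_mx (real_complex R) A) (real_complex R c).
    apply/eigenvalueP; exists (map_mx (real_complex R) u).
      by rewrite -map_mxM uA map_mxZ.
    by rewrite map_mx_eq0.
  by rewrite normc_def/= expr0n/= addr0 sqrtr_sqr lecR; exact/le_trans/ler_norm.
by move=> Pa Pb; apply/le_anti; rewrite !le.
Qed.

Lemma lambda_maxE A a u v : (0 < M)%N -> nonneg_mx A ->
  (forall j, 0 < u 0 j) -> u *m A = a *: u ->
  (forall i, 0 < v i 0) -> A *m v = a *: v -> lambda_max A = a.
Proof.
move=> M0 A0 u0 uA v0 Av; apply: xget_unique.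
  exact: PF_eigenvalue_col uA v0 Av.
move=> b Pb; apply: is_PF_eigenvalue_unique Pb _.
exact: PF_eigenvalue_col uA v0 Av.
Qed.

(** The left and right eigenvalues come from separate existence results; pairing the two positive
    eigenvectors forces them to coincide. *)
Lemma lambda_max_eigenvectors A : (0 < M)%N -> nonneg_mx A -> irreducible A ->
  exists u v, [/\ forall j, 0 < u 0 j, u *m A = lambda_max A *: u,
    forall i, 0 < v i 0 & A *m v = lambda_max A *: v].
Proof.
move=> M0 A0 irrA.
have [a [u [u0 uA]]] := PF_row M0 A0 irrA.
have [b [v [v0 Av]]] := PF_col M0 A0 irrA.
have ba : b = a.
  apply/le_anti/andP; split.
    by apply: (row_eigen_ge M0 u0 uA v0) => i; rewrite Av mxE.
  by apply: (row_eigen_le M0 u0 uA v0) => i; rewrite Av mxE.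
subst b; exists u, v; rewrite (lambda_maxE M0 A0 u0 uA v0 Av).
by split.
Qed.

(** With the next lemma, the Collatz-Wielandt bounds: the estimates on [log_lambda] below reduce to
    the choice of a positive test vector. *)
Lemma lambda_max_le A v c : (0 < M)%N -> nonneg_mx A -> irreducible A ->
  (forall i, 0 < v i 0) -> (forall i, (A *m v) i 0 <= c * v i 0) ->
  lambda_max A <= c.
Proof.
move=> M0 A0 irrA v0 Av.
have [u [_ [u0 uA _ _]]] := lambda_max_eigenvectors M0 A0 irrA.
exact: row_eigen_le uA v0 Av.
Qed.

Lemma lambda_max_ge A v c : (0 < M)%N -> nonneg_mx A -> irreducible A ->
  (forall i, 0 < v i 0) -> (forall i, c * v i 0 <= (A *m v) i 0) ->
  c <= lambda_max A.
Proof.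
move=> M0 A0 irrA v0 Av.
have [u [_ [u0 uA _ _]]] := lambda_max_eigenvectors M0 A0 irrA.
exact: row_eigen_ge uA v0 Av.
Qed.

End PerronFrobenius.

(** * Differentiability of the logarithm of the Perron eigenvalue *)

Section Poisson.
Context {R : realType} {M : nat}.
Implicit Types (Q : 'M[R]_M) (g f : 'cV[R]_M).

(** Maximum principle: an average of values not exceeding the maximum can equal it only if every
    successor attains it, and irreducibility propagates this to all states. *)
Lemma harmonic_max_eq Q g i : stochastic Q -> irreducible Q ->
  (forall i, g i 0 = \sum_j Q i j * g j 0) -> (forall j, g j 0 <= g i 0) ->
  forall j, g j 0 = g i 0.
Proof.
move=> [Q0 Q1] irrQ gQ gmax j.
have step k : g k 0 = g i 0 -> forall l, 0 < Q k l -> g l 0 = g i 0.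
  move=> gk l Qkl.
  have : \sum_l Q k l * (g i 0 - g l 0) = 0.
    under eq_bigr do rewrite mulrBr.
    by rewrite sumrB -mulr_suml Q1 mul1r -gQ gk subrr.
  move/psumr_eq0P => /(_ _ l isT) /eqP.
  rewrite mulf_eq0 gt_eqF//= subr_eq0 => h; apply/esym/eqP/h => m _.
  by rewrite mulr_ge0// subr_ge0.
have [n] := irrQ i j; elim: n j => [|n IH] j.
  by rewrite expr0 mxE; have [->|] := eqVneq i j; rewrite ?ltxx.
rewrite exprSr => /(mulmx_gt0_ex (nonneg_mxX n Q0) Q0)[k /IH gk].
exact: step.
Qed.

Lemma poisson_equation Q f : (0 < M)%N -> stochastic Q -> irreducible Q ->
  exists r g, forall i, f i 0 + \sum_j Q i j * g j 0 = r + g i 0.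
Proof.
move=> M0 sQ irrQ; have [Q0 Q1] := sQ; pose k := Ordinal M0.
(* [1%:M - Q] kills the constants. The added rank-one matrix sends g to the constant g_k, which
   makes [S] injective, and S g = f becomes the Poisson equation with r = g_k. *)
pose S := 1%:M - Q + \matrix_(i, j) (j == k)%:R.
have SE (g : 'cV[R]_M) i : (S *m g) i 0 = g i 0 - \sum_j Q i j * g j 0 + g k 0.
  rewrite !mulmxDl mul1mx mulNmx mxE [X in X + _ = _]mxE; congr (_ + _ + _).
    by rewrite !mxE.
  rewrite mxE (bigD1 k)//= mxE eqxx mul1r big1 ?addr0// => j /negbTE jk.
  by rewrite mxE jk mul0r.
have inj (g : 'cV[R]_M) : S *m g = 0 -> g = 0.
  move=> Sg0; have gS i : g i 0 - \sum_j Q i j * g j 0 + g k 0 = 0.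
    by rewrite -SE Sg0 mxE.
  case: (@arg_maxP _ R _ k xpredT (fun i => g i 0) isT) => i _ gi.
  case: (@arg_minP _ R _ k xpredT (fun i => g i 0) isT) => j _ gj.
  have cst (c : R) l : \sum_m Q l m * c = c by rewrite -mulr_suml Q1 mul1r.
  (* At a maximum of g, g - Q g is nonnegative, and at a minimum nonpositive; as g - Q g is the
     constant -g_k, this constant is 0 and g is harmonic. *)
  have gk : g k 0 = 0.
    apply/le_anti/andP; split.
      have := gS i; suff : \sum_j Q i j * g j 0 <= g i 0 by lra.
      by rewrite -[leRHS](cst _ i); apply: ler_sum => m _;
        apply: ler_wpM2l => //; exact: gi.
    have := gS j; suff : g j 0 <= \sum_m Q j m * g m 0 by lra.
    by rewrite -[leLHS](cst _ j); apply: ler_sum => m _;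
      apply: ler_wpM2l => //; exact: gj.
  have gc l : g l 0 = g i 0.
    apply: (harmonic_max_eq sQ irrQ) => [m|m]; last exact: gi.
    by have := gS m; rewrite gk addr0 => /eqP; rewrite subr_eq0 => /eqP.
  by apply/colP => l; rewrite mxE gc -(gc k) gk.
have S_unit : S \in unitmx.
  rewrite -unitmx_tr -row_free_unit; apply: inj_row_free => v vS.
  apply: trmx_inj; rewrite trmx0; apply: inj.
  by apply: trmx_inj; rewrite trmx_mul trmxK vS trmx0.
exists ((invmx S *m f) k 0), (invmx S *m f) => i.
have := SE (invmx S *m f) i; rewrite mulKVmx// => ->; lra.
Qed.

End Poisson.

(** From 1 - x <= exp(-x) one gets (1 - x) exp(x) <= 1, and (1 - x)(1 + x + 2x^2) = 1 + x^2 (1 - 2x)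
    is at least 1 on this range. *)
Lemma expR_le_quad (R : realType) (x : R) :
  x <= 2^-1 -> expR x <= 1 + x + 2 * x ^+ 2.
Proof.
move=> x2; have x1 : 0 < 1 - x by lra.
rewrite -(ler_pM2r x1) (@le_trans _ _ 1)//; last by nra.
rewrite -[leRHS](expRxMexpNx_1 x) ler_wpM2l ?expR_ge0//; exact: expR_ge1Dx.
Qed.

Section PowerMatrix.
Context {R : realType} {M : nat}.
Variable P : 'M[R]_M.
Hypotheses (M0 : (0 < M)%N) (sP : stochastic P) (irrP : irreducible P).

Let P0 i j : 0 <= P i j. Proof. by case: sP. Qed.

Lemma mx_powR_ge0 t : nonneg_mx (mx_powR P t).
Proof. by move=> i j; rewrite mxE; case: ifP => // _; exact: powR_ge0. Qed.

Lemma mx_powR_gt0 t i j : (0 < mx_powR P t i j) = (0 < P i j).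
Proof.
rewrite mxE; case: eqVneq => [->|Pij]; first by rewrite ltxx.
by rewrite powR_gt0// lt_def Pij P0.
Qed.

Lemma mx_powR1 : mx_powR P 1 = P.
Proof.
by apply/matrixP => i j; rewrite mxE; case: eqVneq => [->//|_]; rewrite powRr1.
Qed.

Lemma irreducible_mx_powR t : irreducible (mx_powR P t).
Proof.
apply: irreducible_sub irrP => //; first exact: mx_powR_ge0.
by move=> i j; rewrite mx_powR_gt0.
Qed.

Lemma stochastic_row_gt0 i : exists j, 0 < P i j.
Proof.
case: sP => _ /(_ i) Pi1.
have [/existsP//|/existsPn h] := boolP [exists j, 0 < P i j].
have := oner_neq0 R; rewrite -Pi1 big1 ?eqxx// => j _.
by apply/le_anti; rewrite P0 andbT leNgt h.
Qed.

Lemma lambda_max_gt0 t : 0 < lambda_max (mx_powR P t).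
Proof.
have [u [v [_ _ v0 Av]]] :=
  lambda_max_eigenvectors M0 (mx_powR_ge0 t) (@irreducible_mx_powR t).
have [j Pj] := stochastic_row_gt0 (Ordinal M0).
rewrite -(pmulr_lgt0 _ (v0 (Ordinal M0))).
have := congr1 (fun y : 'cV_M => y (Ordinal M0) 0) Av.
rewrite [X in _ = X]mxE => <-.
apply: (mulmx_gt0 (k := j)); rewrite ?mx_powR_gt0//; first exact: mx_powR_ge0.
by move=> k l; rewrite ord1 ltW.
Qed.

Definition log_lambda t := ln (lambda_max (mx_powR P t)).

Lemma log_lambda_le t x :
  (log_lambda t <= x) = (lambda_max (mx_powR P t) <= expR x).
Proof. by rewrite -ler_expR lnK// posrE lambda_max_gt0. Qed.

Lemma log_lambda_ge t x :
  (x <= log_lambda t) = (expR x <= lambda_max (mx_powR P t)).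
Proof. by rewrite -[LHS]ler_expR lnK// posrE lambda_max_gt0. Qed.

Lemma log_lambda1 : log_lambda 1 = 0.
Proof.
rewrite /log_lambda mx_powR1; suff -> : lambda_max P = 1 by rewrite ln1.
have v0 : forall i, 0 < (const_mx 1 : 'cV[R]_M) i 0 by move=> i; rewrite mxE.
have Pv i : (P *m (const_mx 1 : 'cV[R]_M)) i 0 = 1 * (const_mx 1 : 'cV[R]_M) i
  0.
  rewrite !mxE mulr1; under eq_bigr do rewrite mxE mulr1.
  by case: sP.
apply/le_anti/andP; split.
  by apply: (lambda_max_le _ _ _ v0) => // i; rewrite Pv.
by apply: (lambda_max_ge _ _ _ v0) => // i; rewrite Pv.
Qed.

(** Entries of [P] are at most 1, so for t <= 1 taking powers does not decrease them and the row
    sums stay at least 1. *)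
Lemma log_lambda_ge0 t : t <= 1 -> 0 <= log_lambda t.
Proof.
move=> t1; rewrite ln_ge0//.
have v0 : forall i, 0 < (const_mx 1 : 'cV[R]_M) i 0 by move=> i; rewrite mxE.
apply: (lambda_max_ge _ (mx_powR_ge0 t) (@irreducible_mx_powR t) v0) => // i.
rewrite mul1r !mxE; under eq_bigr do rewrite [const_mx _ _ _]mxE mulr1.
rewrite -[leLHS](sP.2 i); apply: ler_sum => j _; rewrite mxE.
have [->//|Pij] := eqVneq (P i j) 0.
have Pij1 : P i j <= 1.
  rewrite -[leRHS](sP.2 i) (bigD1 j)//= lerDl.
  by apply: sumr_ge0.
have Pij0 : 0 < P i j by rewrite lt_def Pij P0.
rewrite -{1}[P i j]lnK// /powR (negbTE Pij) ler_expR.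
by have := ln_le0 Pij1; nra.
Qed.

(* Testing [mx_powR P t] against the vector [v_i exp ((t - t0) g_i)], where [v]
   is the Perron eigenvector at [t0] and [g] solves the Poisson equation of the
   associated Markov chain, shows that [log_lambda] is differentiable. *)
Lemma log_lambda_expansion t0 : exists r K e : R, [/\ 0 <= K, 0 < e,
  forall t, log_lambda t0 + (t - t0) * r <= log_lambda t &
  forall t, `|t - t0| <= e ->
    log_lambda t <= log_lambda t0 + (t - t0) * r + K * (t - t0) ^+ 2].
Proof.
pose A := mx_powR P t0; pose lam := lambda_max A.
have A0 : nonneg_mx A := mx_powR_ge0 t0.
have lam0 : 0 < lam := lambda_max_gt0 t0.
have lam_expR : expR (log_lambda t0) = lam by rewrite lnK// posrE.
have [_ [v [_ _ v0 Av]]] := lambda_max_eigenvectors M0 A0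
  (@irreducible_mx_powR t0).
have Avi i : \sum_j A i j * v j 0 = lam * v i 0.
  by have := congr1 (fun y : 'cV_M => y i 0) Av; rewrite !mxE.
(* The Doob transform of [A] by its right Perron eigenvector. *)
pose Q := \matrix_(i, j) (A i j * v j 0 / (lam * v i 0)).
have lv0 i : 0 < lam * v i 0 by rewrite mulr_gt0.
have Q0 : nonneg_mx Q.
  by move=> i j; rewrite mxE divr_ge0// ?mulr_ge0// ltW.
have sQ : stochastic Q.
  split=> // i; under eq_bigr do rewrite mxE.
  by rewrite -mulr_suml Avi divff// gt_eqF.
have irrQ : irreducible Q.
  apply: irreducible_sub (@irreducible_mx_powR t0) => // i j Aij.
  by rewrite mxE divr_gt0// mulr_gt0.
pose f := \col_i \sum_j Q i j * ln (P i j).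
have [r [g fg]] := poisson_equation f M0 sQ irrQ.
(* The coboundary g_j - g_i corrects the increments ln p_ij so that their conditional mean is the
   same number r in every state. *)
pose c i j := ln (P i j) + g j 0 - g i 0.
have Qc i : \sum_j Q i j * c i j = r.
  under eq_bigr do rewrite /c mulrBr mulrDr.
  rewrite sumrB big_split/= -mulr_suml; case: (sQ) => _ ->; rewrite mul1r.
  by have := fg i; rewrite mxE; lra.
pose C := 1 + \sum_i \sum_j `|c i j|.
have C1 : 1 <= C by rewrite lerDl sumr_ge0// => i _; rewrite sumr_ge0.
have cC i j : `|c i j| <= C.
  rewrite /C (bigD1 i)//= (bigD1 j)//= addrCA -addrA lerDl.
  by rewrite !addr_ge0 ?sumr_ge0// => k _; rewrite sumr_ge0.
pose w t := \col_i (v i 0 * expR ((t - t0) * g i 0)).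
have w0 t i : 0 < w t i 0 by rewrite mxE mulr_gt0// expR_gt0.
have Aw t i : (mx_powR P t *m w t) i 0 =
    lam * (\sum_j Q i j * expR ((t - t0) * c i j)) * w t i 0.
  rewrite !mxE -mulrA mulrCA mulr_suml; apply: eq_bigr => j _.
  rewrite !mxE; have [_|Pij] := eqVneq (P i j) 0;
    first by rewrite !(mul0r, mulr0).
  rewrite /powR (negbTE Pij) /c.
  have -> : t * ln (P i j) = t0 * ln (P i j) + (t - t0) * ln (P i j) by lra.
  rewrite expRD !mulrDr mulrN !expRD expRN.
  have vi := lt0r_neq0 (v0 i); have li := lt0r_neq0 lam0.
  have ei := lt0r_neq0 (expR_gt0 ((t - t0) * g i 0)).
  by field; rewrite vi li ei.
(* The radius gives |(t - t0) c_ij| <= 1/2, the range of [expR_le_quad], whose quadratic term is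
   then at most 2 C^2 (t - t0)^2. *)
exists r, (2 * C ^+ 2), (2 * C)^-1; split.
- by rewrite mulr_ge0// sqr_ge0.
- by rewrite invr_gt0; lra.
- move=> t; rewrite log_lambda_ge expRD lam_expR.
  apply: (lambda_max_ge M0 (mx_powR_ge0 t) (@irreducible_mx_powR t) (w0 t)) =>
    i.
  rewrite Aw ler_pM2r// ler_pM2l//.
  (* Jensen's inequality by hand: the exponential lies above its tangent at the mean (t - t0) r, and
     the linear term averages to zero. *)
  have -> : expR ((t - t0) * r) = \sum_j Q i j * (expR ((t - t0) * r) * (1 +
    (t - t0) * (c i j - r))).
    have E j : Q i j * (expR ((t - t0) * r) * (1 + (t - t0) * (c i j - r))) =
        expR ((t - t0) * r) * ((1 - (t - t0) * r) * Q i j + (t - t0) * (Q i j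
          * c i j)).
      by ring.
    rewrite (eq_bigr _ (fun j _ => E j)).
    rewrite -mulr_sumr big_split/= -!mulr_sumr Qc; case: (sQ) => _ ->; ring.
  apply: ler_sum => j _; rewrite ler_wpM2l//.
  have -> : (t - t0) * c i j = (t - t0) * r + (t - t0) * (c i j - r) by ring.
  by rewrite expRD ler_pM2l ?expR_gt0// expR_ge1Dx.
- move=> t te; rewrite log_lambda_le -addrA expRD lam_expR.
  apply: (lambda_max_le M0 (mx_powR_ge0 t) (@irreducible_mx_powR t) (w0 t)) =>
    i.
  rewrite Aw ler_pM2r// ler_pM2l//.
  apply: (@le_trans _ _ (1 + ((t - t0) * r + 2 * C ^+ 2 * (t - t0) ^+ 2)));
    last exact: expR_ge1Dx.
  apply: (@le_trans _ _ (\sum_j Q i j * (1 + (t - t0) * c i j + 2 * C ^+ 2 *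
    (t - t0) ^+ 2))); last first.
    have E j : Q i j * (1 + (t - t0) * c i j + 2 * C ^+ 2 * (t - t0) ^+ 2) =
        (1 + 2 * C ^+ 2 * (t - t0) ^+ 2) * Q i j + (t - t0) * (Q i j * c i j).
      by ring.
    by rewrite (eq_bigr _ (fun j _ => E j)) big_split/= -!mulr_sumr Qc;
      case: (sQ) => _ ->; lra.
  apply: ler_sum => j _; rewrite ler_wpM2l//.
  have c2 : (c i j) ^+ 2 <= C ^+ 2.
    by rewrite -[leLHS]real_normK ?num_real// lerXn2r ?nnegrE// (le_trans _ C1).
  apply: (@le_trans _ _ (1 + (t - t0) * c i j + 2 * ((t - t0) * c i j) ^+ 2)).
    apply: expR_le_quad; rewrite (le_trans (ler_norm _))// normrM.
    apply: (@le_trans _ _ ((2 * C)^-1 * C)); first by rewrite ler_pM.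
    by rewrite invfM mulrAC -mulrA divff ?mulr1// gt_eqF// (lt_le_trans _ C1).
  rewrite lerD2l exprMn -mulrA [C ^+ 2 * _]mulrC ler_pM2l// ler_wpM2l//
    sqr_ge0//.
Qed.

End PowerMatrix.

(** * Minimizing h(u)/u *)

Lemma local_lipschitz_continuous (R : realType) (f : R -> R) (a K e : R) :
  0 < e -> (forall x, `|x - a| <= e -> `|f x - f a| <= K * `|x - a|) ->
  f x @[x --> a] --> f a.
Proof.
move=> e0 fK; have K1 : 0 < `|K| + 1 by rewrite ltr_wpDl.
apply/cvgrPdist_le => eps eps0; near=> x.
have xe : `|x - a| <= e.
  by rewrite distrC; near: x; apply: cvgr_dist_le => //; exact: cvg_id.
have xd : `|x - a| <= eps / (`|K| + 1).
  rewrite distrC; near: x; apply: cvgr_dist_le; first exact: cvg_id.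
  by rewrite divr_gt0.
rewrite distrC (le_trans (fK _ xe))//.
rewrite (@le_trans _ _ ((`|K| + 1) * (eps / (`|K| + 1))))//; last first.
  by rewrite mulrC divfK// gt_eqF.
apply: (@le_trans _ _ ((`|K| + 1) * `|x - a|)).
  by rewrite ler_wpM2r// (le_trans (ler_norm K))// lerDl.
by rewrite ler_pM2l.
Unshelve. all: by end_near. Qed.

Section Duality.
Context {R : realType}.
Variables (ell : R -> R) (b : R).
Hypothesis b0 : 0 < b.
Hypothesis ell_expansion : forall t0, exists r K e : R, [/\ 0 <= K, 0 < e,
  forall t, ell t0 + (t - t0) * r <= ell t &
  forall t, `|t - t0| <= e ->
    ell t <= ell t0 + (t - t0) * r + K * (t - t0) ^+ 2].
Hypothesis ell1 : ell 1 = 0.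
Hypothesis ell_ge0 : forall t, t <= 1 -> 0 <= ell t.

Definition gauss_pressure u := ell u + u ^+ 2 * b ^+ 2 / 2.
Notation h := gauss_pressure.

(** The derivative of [ell], obtained by choice as the slope in the two-sided expansion. *)
Let r t := sval (cid (ell_expansion t)).

Let r_tangent t0 t : ell t0 + (t - t0) * r t0 <= ell t.
Proof. by rewrite /r; case: (cid _) => /= ? [? [? []]]. Qed.

Let r_quad t0 : exists K e, [/\ 0 <= K, 0 < e & forall t, `|t - t0| <= e ->
  ell t <= ell t0 + (t - t0) * r t0 + K * (t - t0) ^+ 2].
Proof. by rewrite /r; case: (cid _) => /= ? [K [e []]]; exists K, e. Qed.

Let ell_cont t0 : ell x @[x --> t0] --> ell t0.
Proof.
have [K [e [K0 e0 q]]] := r_quad t0.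
apply: (@local_lipschitz_continuous _ _ _ (`|r t0| + K * e) e e0) => x xe.
have := q _ xe; have := r_tangent t0 x.
set y := x - t0 in xe *; move=> h1 h2.
have y2 : y ^+ 2 = `|y| * `|y| by rewrite -expr2 real_normK// num_real.
have yr : `|y * r t0| = `|y| * `|r t0| by rewrite normrM.
have y3 : K * (`|y| * `|y|) <= K * (e * `|y|).
  by rewrite ler_wpM2l// ler_wpM2r.
have y4 : 0 <= K * (`|y| * `|y|) by rewrite !mulr_ge0.
have := ler_norm (y * r t0); have := ler_norm (- (y * r t0)); rewrite normrN yr.
by rewrite y2 in h2; move=> *; rewrite ler_norml; apply/andP; split; lra.
Qed.

Let r_nondecreasing t1 t2 : t1 < t2 -> r t1 <= r t2.
Proof.
by move=> t12; have := r_tangent t1 t2; have := r_tangent t2 t1; nra.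
Qed.

(* [r] is squeezed between the slope of the tangent at [t0] and the slope of
   the chord from [t] to [2 t - t0]. *)
Let r_cont t0 : r x @[x --> t0] --> r t0.
Proof.
have [K [e [K0 e0 q]]] := r_quad t0.
have e2 : 0 < e / 2 by rewrite divr_gt0.
apply: (@local_lipschitz_continuous _ _ _ (4 * K) _ e2) => x xe.
have xe' : `|(2 * x - t0) - t0| <= e.
  have -> : 2 * x - t0 - t0 = 2 * (x - t0) by ring.
  by rewrite normrM ger0_norm//; lra.
have h1 := q _ xe'; have h2 := r_tangent x (2 * x - t0).
have h3 := r_tangent t0 x; have h4 := r_tangent x t0.
have up : (x - t0) * (r x - r t0) <= 4 * K * (x - t0) ^+ 2.
  have -> : (x - t0) ^+ 2 = (x - t0) * (x - t0) by ring.
  by nra.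
have lo : 0 <= (x - t0) * (r x - r t0) by nra.
have [->|xt] := eqVneq x t0; first by rewrite !subrr normr0 mulr0.
have n0 : 0 < `|x - t0| by rewrite normr_gt0 subr_eq0.
rewrite -(ler_pM2l n0) -normrM ger0_norm//.
by rewrite mulrCA -expr2 real_normK// num_real.
Qed.

(* u^2 times the derivative of [h u / u] *)
Let D u := u * r u - ell u + u ^+ 2 * b ^+ 2 / 2.

Let D_cont : continuous D.
Proof.
move=> u; apply: cvgD; last first.
  by apply: cvgMr_tmp; apply: cvgMr_tmp; apply: cvgM; exact: cvg_id.
by apply: cvgB; [apply: cvgM; [exact: cvg_id|exact: r_cont]|exact: ell_cont].
Qed.

(** [u * r u - ell u] is nondecreasing for u >= 0 by convexity of [ell]; strictness comes from the
    Gaussian term. *)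
Let D_increasing u1 u2 : 0 <= u1 -> u1 < u2 -> D u1 < D u2.
Proof.
move=> u10 u12; rewrite /D.
have h1 := r_tangent u2 u1; have h2 := r_nondecreasing u12.
have b2 : 0 < b ^+ 2 by rewrite exprn_gt0.
have : 0 < (u2 ^+ 2 - u1 ^+ 2) * b ^+ 2 by rewrite mulr_gt0//; nra.
have : 0 <= u1 * (r u2 - r u1) by rewrite mulr_ge0// subr_ge0.
by nra.
Qed.

(** At p = 1 the function h(pu) - p h(u) vanishes and has derivative [D u] < 0, so every p slightly
    above 1 works. *)
Let superconvex_exponent u : 0 < u -> u < 1 -> D u < 0 ->
  exists p, [/\ 1 < p, p <= 2 & h (p * u) < p * h u].
Proof.
move=> u0 u1 Du; have [K [e [K0 e0 q]]] := r_quad u.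
have b2 : 0 < b ^+ 2 by rewrite exprn_gt0.
pose K' := K + b ^+ 2 / 2; have K'0 : 0 < K' by rewrite /K'; lra.
(* The cap 1 keeps p <= 2, [e] keeps p u within the quadratic bound, and the last term lets the
   linear gain d (- D u) beat the quadratic error. *)
pose d := Num.min 1 (Num.min e (- D u / (2 * K'))).
have d0 : 0 < d.
  by rewrite !lt_min ltr01 e0 divr_gt0// ?oppr_gt0// mulr_gt0.
have d1 : d <= 1 by rewrite ge_min lexx.
have de : d <= e by rewrite !ge_min lexx orbT.
have dD : d * K' < - D u.
  have : d <= - D u / (2 * K') by rewrite !ge_min lexx !orbT.
  by rewrite ler_pdivlMr ?mulr_gt0//; nra.
exists (1 + d); split; [lra|lra|].
have due : `|(1 + d) * u - u| <= e.
  have -> : (1 + d) * u - u = d * u by ring.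
  by rewrite ger0_norm; nra.
have := q _ due; have -> : (1 + d) * u - u = d * u by ring.
rewrite /h => qu.
have u2 : u ^+ 2 <= 1 by rewrite expr_le1// ltW.
have : d * (d * K' * u ^+ 2) < d * (- D u).
  rewrite ltr_pM2l// (le_lt_trans _ dD)// ler_piMr// mulr_ge0// ltW//.
have := K'0; rewrite /D /K'.
have -> : ((1 + d) * u) ^+ 2 = u ^+ 2 + 2 * d * u ^+ 2 + d ^+ 2 * u ^+ 2
  by ring.
rewrite exprMn in qu.
by nra.
Qed.

(** Both alternatives make the tangent of h at [th] take the value h(th)/th at 1. It is approximated
    by a chord between two points strictly below [th], where exponents p are available. *)
Let low_temperature_tangent th : 0 < th -> th <= 1 ->
  (forall u, 0 < u -> u < th -> D u < 0) -> th = 1 \/ D th = 0 ->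
  forall eps, 0 < eps -> exists u' u p, [/\ 0 < u' < u, u < 1, 1 < p <= 2,
    h (p * u) < p * h u &
    h th / th - eps <= h u' + (1 - u') * ((h u - h u') / (u - u'))].
Proof.
move=> th0 th1 Dneg thD eps eps0; have [K [e [K0 e0 q]]] := r_quad th.
have b2 : 0 < b ^+ 2 by rewrite exprn_gt0.
pose K' := K + b ^+ 2 / 2; have K'0 : 0 < K' by rewrite /K'; lra.
(* The derivative of h at [th]. *)
pose H := r th + th * b ^+ 2.
have HV : h th / th = h th + (1 - th) * H.
  case: thD => [->|Dth]; first by rewrite divr1 subrr mul0r addr0.
  suff -> : h th = th * H by field; rewrite gt_eqF.
  by move: Dth; rewrite /D /h /H; nra.
(* The chord joins th - 2d to th - d: the first term keeps both points positive, the second keeps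
   them within the expansion, and the third bounds the slope error 4 K' d by [eps]. *)
pose d := Num.min (th / 3) (Num.min (e / 2) (eps / (4 * K'))).
have d0 : 0 < d by rewrite !lt_min !divr_gt0// mulr_gt0.
have dth : 3 * d <= th.
  have : d <= th / 3 by rewrite ge_min lexx.
  by lra.
have de : 2 * d <= e.
  have : d <= e / 2 by rewrite !ge_min lexx orbT.
  by lra.
have deps : 4 * K' * d <= eps.
  have : d <= eps / (4 * K') by rewrite !ge_min lexx !orbT.
  by rewrite ler_pdivlMr ?mulr_gt0//; lra.
have ud0 : 0 < th - d by lra.
have uth : th - d < th by lra.
have ul1 : th - d < 1 by lra.
have [p [p1 p2 hp]] := superconvex_exponent ud0 ul1 (Dneg _ ud0 uth).
exists (th - 2 * d), (th - d), p; split => //; [by apply/andP; split;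
  lra|by rewrite p1|].
rewrite HV.
have u2e : `|(th - 2 * d) - th| <= e by rewrite ler_norml; lra.
have := q _ u2e; have -> : th - 2 * d - th = - (2 * d) by ring.
have := r_tangent th (th - d); have := r_tangent th (th - 2 * d).
have -> : th - 2 * d - th = - (2 * d) by ring.
have -> : th - d - th = - d by ring.
have -> : th - d - (th - 2 * d) = d by ring.
move=> h1 h2 h3.
have hu2 : h th - 2 * d * H <= h (th - 2 * d).
  have : 0 <= d ^+ 2 * b ^+ 2 by rewrite mulr_ge0 ?sqr_ge0.
  rewrite /h /H.
  have -> : (th - 2 * d) ^+ 2 = th ^+ 2 - 4 * th * d + 4 * d ^+ 2 by ring.
  by nra.
have hu : h th - d * H <= h (th - d).
  have : 0 <= d ^+ 2 * b ^+ 2 by rewrite mulr_ge0 ?sqr_ge0.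
  rewrite /h /H.
  have -> : (th - d) ^+ 2 = th ^+ 2 - 2 * th * d + d ^+ 2 by ring.
  by nra.
have hu2' : h (th - 2 * d) <= h th - 2 * d * H + 4 * K' * d ^+ 2.
  rewrite /h /H /K'.
  have -> : (th - 2 * d) ^+ 2 = th ^+ 2 - 4 * th * d + 4 * d ^+ 2 by ring.
  have e3 : (- (2 * d)) ^+ 2 = 4 * d ^+ 2 by ring.
  rewrite e3 in h3.
  by nra.
have slope : H - 4 * K' * d <= (h (th - d) - h (th - 2 * d)) / d.
  by rewrite ler_pdivlMr//; nra.
have : (1 - (th - 2 * d)) * (H - 4 * K' * d) <=
    (1 - (th - 2 * d)) * ((h (th - d) - h (th - 2 * d)) / d).
  by rewrite ler_wpM2l//; lra.
have : (1 - (th - 2 * d)) * (4 * K' * d) <= eps.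
  rewrite (le_trans _ deps)// ler_piMl//; last by lra.
  by rewrite !mulr_ge0// ltW.
by nra.
Qed.

(** [D th = 0] says 2 (ell th - th r(th)) = (th b)^2, so xi = th b sits on the boundary of the
    admissible interval. *)
Let attained th : 0 <= th -> th <= 1 -> D th = 0 ->
  exists t0 rho xi, [/\ forall t, ell t0 - t0 * rho <= ell t - t * rho,
   `|xi| <= Num.sqrt (2 * (ell t0 - t0 * rho)) &
   ell t0 - t0 * rho - xi ^+ 2 / 2 + (b * xi + rho) = r th + th * b ^+ 2].
Proof.
move=> th0 th1 Dth; exists th, (r th), (th * b); split.
- by move=> t; have := r_tangent th t; lra.
- have -> : 2 * (ell th - th * r th) = (th * b) ^+ 2.
    by move: Dth; rewrite /D exprMn; lra.
  by rewrite sqrtr_sqr.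
- by move: Dth; rewrite /D exprMn; lra.
Qed.

(** V is the infimum of h(u)/u on (0, 1]. The sign of [D] decides where it is reached: at 1, at an
    interior zero of [D], or only in the limit u -> 0. The [eps] in the first clause covers the last
    case. *)
Lemma gauss_pressure_duality : exists V : R, [/\
  forall eps, 0 < eps -> exists th, 0 < th <= 1 /\ h th / th <= V + eps,
  V <= 0 \/ (forall eps, 0 < eps -> exists u' u p, [/\ 0 < u' < u, u < 1,
    1 < p <= 2, h (p * u) < p * h u &
    V - eps <= h u' + (1 - u') * ((h u - h u') / (u - u'))]) &
  exists t0 rho xi, [/\ forall t, ell t0 - t0 * rho <= ell t - t * rho,
   `|xi| <= Num.sqrt (2 * (ell t0 - t0 * rho)) &
   ell t0 - t0 * rho - xi ^+ 2 / 2 + (b * xi + rho) = V]].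
Proof.
have [D1|D1] := leP (D 1) 0.
  exists (h 1 / 1); split.
  - by move=> eps eps0; exists 1; split; [rewrite ltr01 lexx|lra].
  - right; apply: low_temperature_tangent => //; last by left.
    by move=> u u0 u1; apply: lt_le_trans D1; apply: D_increasing => //;
      exact: ltW.
  - exists 1, (r 1), b; split.
    + by move=> t; have := r_tangent 1 t; lra.
    + rewrite gtr0_norm// -[leLHS]gtr0_norm// -sqrtr_sqr ler_wsqrtr//.
      by move: D1; rewrite /D; lra.
    + by rewrite /h; lra.
have D0 : D 0 <= 0.
  by rewrite /D mul0r expr0n/= !mul0r addr0 sub0r oppr_le0 ell_ge0.
have [th] : exists2 c, c \in `[0, 1]%R & D c = 0.
  apply: IVT => //; first exact: continuous_subspaceT.
  by rewrite ge_min D0/= le_max (ltW D1) orbT.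
rewrite in_itv/= le_eqVlt => /andP[/predU1P[<-|th0] th1] Dth.
  (* Here h(u)/u tends to r(0) as u -> 0, and the tangent at 0, evaluated at 1, shows r(0) <= 0. *)
  have ell0 : ell 0 = 0 by move: Dth; rewrite /D; lra.
  have r0 : r 0 <= 0 by have := r_tangent 0 1; rewrite ell0 ell1; lra.
  exists (r 0); split; last first.
  - have [t0 [rho [xi H]]] := attained (lexx _) ler01 Dth.
    by exists t0, rho, xi; rewrite mul0r addr0 in H.
  - by left.
  - move=> eps eps0; have [K [e [K0 e0 q]]] := r_quad 0.
    have b2 : 0 < b ^+ 2 by rewrite exprn_gt0.
    pose K' := K + b ^+ 2 / 2; have K'0 : 0 < K' by rewrite /K'; lra.
    pose d := Num.min 1 (Num.min e (eps / K')).
    have d0 : 0 < d by rewrite !lt_min !divr_gt0// e0 ltr01.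
    have d1 : d <= 1 by rewrite ge_min lexx.
    have de : d <= e by rewrite !ge_min lexx orbT.
    have deps : K' * d <= eps.
      have : d <= eps / K' by rewrite !ge_min lexx !orbT.
      by rewrite ler_pdivlMr//; lra.
    exists d; split; first by rewrite d0.
    have dE : `|d - 0| <= e by rewrite subr0 gtr0_norm.
    have := q _ dE; rewrite subr0 ell0 /h => qd.
    rewrite ler_pdivrMr// (le_trans (lerD qd (lexx _)))//.
    have : d * (K' * d) <= d * eps by rewrite ler_pM2l.
    by rewrite /K'; nra.
exists (h th / th).
have hth : h th / th = r th + th * b ^+ 2.
  suff -> : h th = th * (r th + th * b ^+ 2) by field; rewrite gt_eqF.
  by move: Dth; rewrite /D /h; nra.
split.
- by move=> eps eps0; exists th; split; [rewrite th0|lra].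
- right; apply: low_temperature_tangent => //; last by right.
  by move=> u u0 uth; rewrite -Dth; apply: D_increasing => //; exact: ltW.
- by rewrite hth; apply: attained => //; exact: ltW.
Qed.

End Duality.

(** * Path sums *)

Lemma big_tuple_cons (R : nmodType) (T : finType) n (F : seq T -> R) :
  \sum_(s : n.+1.-tuple T) F s = \sum_i \sum_(s : n.-tuple T) F (i :: s).
Proof.
rewrite pair_bigA/=.
rewrite (reindex (fun q : T * n.-tuple T => [tuple of q.1 :: q.2]))//=.
exists (fun s : n.+1.-tuple T => (thead s, [tuple of behead s])).
  by move=> [i s] _ /=; congr pair; apply/val_inj.
by move=> s _; rewrite [RHS]tuple_eta; apply/val_inj.
Qed.

Section PathSums.
Context {R : realType} {M : nat}.
Implicit Types (A P : 'M[R]_M) (u pi : 'rV[R]_M).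

Lemma sum_path_prob A u n :
  \sum_(s : n.+1.-tuple 'I_M) path_prob u A s = (u *m A ^+ n *m (const_mx 1 :
    'cV[R]_M)) 0 0.
Proof.
have step i : \sum_(s : n.-tuple 'I_M)
    \prod_(q <- pairmap (fun j k => A j k) i s) q = (A ^+ n *m (const_mx 1 :
      'cV[R]_M)) i 0.
  elim: n i => [|n IH] i.
    rewrite (bigD1 [tuple])//= big_nil big1 ?addr0 => [|s /eqP[]]; last first.
      exact: tuple0.
    rewrite expr0 mxE (bigD1 i)//= !mxE eqxx mulr1 big1 ?addr0// => j.
    by rewrite !mxE eq_sym => /negbTE ->; rewrite mul0r.
  rewrite (big_tuple_cons _ (fun s => \prod_(q <- pairmap (fun j k => A j k) i
    s) q)).
  rewrite exprS -mulmxE -mulmxA mxE; apply: eq_bigr => j _.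
  by under eq_bigr do rewrite /= big_cons; rewrite -mulr_sumr IH.
rewrite (big_tuple_cons _ (path_prob u A))/= -mulmxA mxE; apply: eq_bigr => i _.
by rewrite -mulr_sumr step.
Qed.

Lemma path_prob_ge0 pi P s : (forall i, 0 <= pi 0 i) -> nonneg_mx P ->
  0 <= path_prob pi P s.
Proof.
move=> pi0 P0; case: s => //= i s; rewrite mulr_ge0//.
by elim: s i => [|j s IH] i; rewrite /= ?big_nil// big_cons mulr_ge0.
Qed.

(** The condition on t keeps impossible transitions at weight 0, since zero to the power zero is
    one. *)
Lemma path_prob_powR pi P t s : t != 0 ->
  (forall i, 0 <= pi 0 i) -> nonneg_mx P ->
  path_prob pi P s `^ t = path_prob (\row_i (pi 0 i `^ t)) (mx_powR P t) s.
Proof.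
move=> t0 pi0 P0; case: s => [|i s]; first by rewrite /= powR1.
have pr0 j : 0 <= \prod_(q <- pairmap (fun j k => P j k) j s) q.
  by elim: s j => [|k s IH] j; rewrite /= ?big_nil// big_cons mulr_ge0.
rewrite /= powRM// mxE; congr (_ * _).
elim: s i {pr0} => [|j s IH] i /=; first by rewrite !big_nil powR1.
have pr0 k : 0 <= \prod_(q <- pairmap (fun j k => P j k) k s) q.
  by elim: s k {IH} => [|l s IH] k; rewrite /= ?big_nil// big_cons mulr_ge0.
rewrite !big_cons powRM// IH mxE; congr (_ * _).
by case: eqVneq => // ->; rewrite powR0.
Qed.

Variables (P : 'M[R]_M) (pi : 'rV[R]_M).
Hypotheses (M0 : (0 < M)%N) (sP : stochastic P) (irrP : irreducible P).
Hypotheses (pi0 : forall i, 0 <= pi 0 i) (pi1 : \sum_i pi 0 i = 1).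

Lemma sum_path_prob1 N : (0 < N)%N -> \sum_(s : N.-tuple 'I_M) path_prob pi P
  s = 1.
Proof.
case: N => // n _; rewrite sum_path_prob.
have Pv : P *m (const_mx 1 : 'cV[R]_M) = const_mx 1.
  apply/colP => i; rewrite !mxE; under eq_bigr do rewrite mxE mulr1.
  by case: sP.
have -> : pi *m P ^+ n *m const_mx 1 = pi *m (const_mx 1 : 'cV[R]_M).
  elim: n => [|n IH]; first by rewrite expr0 mulmx1.
  by rewrite exprSr -mulmxE mulmxA -mulmxA Pv.
by rewrite mxE; under eq_bigr do rewrite mxE mulr1.
Qed.

(** Pigeonhole over the M^N paths. Such a path bounds the partition sum from below with a loss only
    linear in N. *)
Lemma exists_likely_path N : (0 < N)%N -> exists s : N.-tuple 'I_M,
  - (N%:R * ln M%:R) <= ln (path_prob pi P s) /\ 0 < path_prob pi P s.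
Proof.
move=> N0; have MN0 : 0 < M%:R ^+ N :> R by rewrite exprn_gt0// ltr0n.
suff [s sM] : exists s : N.-tuple 'I_M, (M%:R ^+ N)^-1 <= path_prob pi P s.
  have W0 : 0 < path_prob pi P s by rewrite (lt_le_trans _ sM)// invr_gt0.
  exists s; split => //.
  have -> : - (N%:R * ln M%:R) = ln ((M%:R ^+ N)^-1) :> R.
    by rewrite lnV// lnXn ?ltr0n// mulr_natl.
  by rewrite ler_ln// posrE invr_gt0.
apply/not_existsP => h.
have := sum_path_prob1 N0; apply/eqP; rewrite lt_eqF//.
have -> : 1 = \sum_(s : N.-tuple 'I_M) (M%:R ^+ N)^-1 :> R.
  by rewrite sumr_const card_tuple card_ord -[RHS]mulr_natr natrX mulVf//
    gt_eqF.
apply: ltr_sum => [|s _]; last by rewrite ltNge; apply/negP/h.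
by apply/hasP; exists [tuple of nseq N (Ordinal M0)]; rewrite ?mem_index_enum.
Qed.

(** The sum is u A^n 1, and replacing 1 by the Perron eigenvector [v] gives lam^n (u v) exactly, at
    the price of factors independent of n. *)
Lemma ln_sum_path_powR t : 0 < t -> exists c, forall N, (0 < N)%N ->
  0 < \sum_(s : N.-tuple 'I_M) path_prob pi P s `^ t /\
  `|ln (\sum_(s : N.-tuple 'I_M) path_prob pi P s `^ t) - N%:R * log_lambda P
    t| <= c.
Proof.
move=> t0; pose A := mx_powR P t; pose lam := lambda_max A.
have P0 : nonneg_mx P by case: sP.
have A0 : nonneg_mx A := mx_powR_ge0 P t.
have lam0 : 0 < lam := lambda_max_gt0 M0 sP irrP t.
have [_ [v [_ _ v0 Av]]] := lambda_max_eigenvectors M0 A0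
  (@irreducible_mx_powR _ _ _ sP irrP t).
pose u := \row_i (pi 0 i `^ t).
have u0 i : 0 <= u 0 i by rewrite mxE powR_ge0.
have uv0 : 0 < (u *m v) 0 0.
  have [i pii] : exists i, 0 < pi 0 i.
    apply/not_existsP => h; have := oner_neq0 R;
      rewrite -pi1 big1 ?eqxx// => i _.
    by apply/le_anti; rewrite pi0 andbT leNgt; apply/negP/h.
  apply: (mulmx_gt0 (k := i)) => // [j k|j k|]; rewrite ?ord1 ?(ltW (v0 _))//.
  by rewrite mxE powR_gt0.
have AXv n : A ^+ n *m v = lam ^+ n *: v.
  elim: n => [|n IH]; first by rewrite !expr0 mul1mx scale1r.
  by rewrite exprS -mulmxE -mulmxA IH -scalemxAr Av scalerA exprSr.
pose S n := (u *m A ^+ n *m (const_mx 1 : 'cV[R]_M)) 0 0.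
have uX0 n i : 0 <= (u *m A ^+ n) 0 i.
  by rewrite mxE sumr_ge0// => j _; rewrite mulr_ge0//; exact: nonneg_mxX.
have uXv n : (u *m A ^+ n *m v) 0 0 = lam ^+ n * (u *m v) 0 0.
  by rewrite -mulmxA AXv -scalemxAr [LHS]mxE.
(* [a] dominates every coordinate of [v], and [b] every inverse coordinate. *)
pose a := \sum_i v i 0; pose b := \sum_i (v i 0)^-1.
have a0 : 0 < a.
  by rewrite /a (bigD1 (Ordinal M0))//= ltr_pwDl// sumr_ge0// => i _;
    rewrite ltW.
have b0 : 0 < b.
  rewrite /b (bigD1 (Ordinal M0))//= ltr_pwDl ?invr_gt0// sumr_ge0// => i _.
  by rewrite invr_ge0 ltW.
have SE n : S n = \sum_i (u *m A ^+ n) 0 i.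
  by rewrite /S mxE; apply: eq_bigr => i _; rewrite [const_mx _ _ _]mxE mulr1.
have vE n : (u *m A ^+ n *m v) 0 0 = \sum_i (u *m A ^+ n) 0 i * v i 0.
  by rewrite mxE.
have lo n : lam ^+ n * (u *m v) 0 0 / a <= S n.
  rewrite ler_pdivrMr// -uXv SE vE mulr_suml; apply: ler_sum => i _.
  rewrite ler_wpM2l// /a (bigD1 i)//= lerDl sumr_ge0// => j _.
  by rewrite ltW.
have hi n : S n <= lam ^+ n * (u *m v) 0 0 * b.
  rewrite -uXv SE vE mulr_suml; apply: ler_sum => i _.
  rewrite -mulrA ler_peMr// -[leLHS](divff (lt0r_neq0 (v0 i))) ler_wpM2l ?(ltW
    (v0 _))//.
  by rewrite /b (bigD1 i)//= lerDl sumr_ge0// => j _; rewrite invr_ge0 ltW.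
(* A path with n + 1 states has n transitions, hence the correction by [ln lam]. *)
exists (`|ln ((u *m v) 0 0 / a) - ln lam| + `|ln ((u *m v) 0 0 * b) - ln lam|).
case=> // n _.
have -> : \sum_(s : n.+1.-tuple 'I_M) path_prob pi P s `^ t = S n.
  rewrite /S -sum_path_prob; apply: eq_bigr => s _.
  by rewrite path_prob_powR// gt_eqF.
have lamn : 0 < lam ^+ n by rewrite exprn_gt0.
have uva : 0 < (u *m v) 0 0 / a by rewrite divr_gt0.
have uvb : 0 < (u *m v) 0 0 * b by rewrite mulr_gt0.
have S0 : 0 < S n by rewrite (lt_le_trans _ (lo n))// -mulrA mulr_gt0.
split=> //.
have : ln (lam ^+ n * (u *m v) 0 0 / a) <= ln (S n).
  by rewrite ler_ln ?posrE// -mulrA mulr_gt0.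
have : ln (S n) <= ln (lam ^+ n * (u *m v) 0 0 * b).
  by rewrite ler_ln ?posrE// -mulrA mulr_gt0.
rewrite -!mulrA !(lnM (x := lam ^+ n)) ?posrE// lnXn// -[ln lam *+ n]mulr_natl.
rewrite /log_lambda -/A -/lam -natr1 mulrDl mul1r.
set x := ln (S n); set y := n%:R * ln lam.
set p := ln (_ / a); set q := ln (_ * b).
have := ler_norm (q - ln lam); have := ler_norm (- (p - ln lam));
  rewrite normrN.
have := normr_ge0 (q - ln lam); have := normr_ge0 (p - ln lam).
by move=> *; rewrite ler_norml; apply/andP; split; lra.
Qed.

End PathSums.

(** * Gaussian moments and pairwise independence *)

Section Gaussian.
Context {R : realType}.
Local Notation mu := (@lebesgue_measure R).

(** The density and the Radon-Nikodym derivative have the same integral over every measurable set,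
    hence agree almost everywhere. *)
Lemma ge0_integral_normal_prob (m s : R) (f : R -> \bar R) :
  measurable_fun setT f -> (forall y, (0 <= f y)%E) ->
  (\int[normal_prob m s]_y f y = \int[mu]_y (f y * (normal_pdf m s y)%:E))%E.
Proof.
move=> mf f0; have dom := normal_prob_dominates m s.
rewrite -(Radon_Nikodym_SigmaFinite.change_of_variables dom)//.
have mRN : measurable_fun setT
    (Radon_Nikodym_SigmaFinite.f (normal_prob m s) mu).
  exact: measurable_int (Radon_Nikodym_SigmaFinite.f_integrable dom).
apply: ae_eq_integral => //.
- exact: emeasurable_funM.
- apply: emeasurable_funM => //; apply/measurable_EFinP.
  exact: measurable_normal_pdf.
- apply: ae_eqe_mul2l; apply: integral_ae_eq => //.
  + exact: Radon_Nikodym_SigmaFinite.f_integrable.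
  + by apply/measurable_EFinP; exact: measurable_normal_pdf.
  + by move=> E _ mE; rewrite -Radon_Nikodym_SigmaFinite.f_integral.
Qed.

(** Completing the square: exponential tilting shifts the mean to c s^2. *)
Lemma expR_normal_pdf (s c x : R) : s != 0 ->
  expR (c * x) * normal_pdf 0 s x =
  expR (c ^+ 2 * s ^+ 2 / 2) * normal_pdf (c * s ^+ 2) s x.
Proof.
move=> s0; rewrite !normal_pdfE// mulrCA [RHS]mulrCA; congr (_ * _).
rewrite /normal_fun -!expRD; congr expR; rewrite -[s ^+ 2 *+ 2]mulr_natr.
by field.
Qed.

Lemma normal_prob_mgf (s c : R) : s != 0 ->
  (\int[normal_prob 0 s]_y (expR (c * y))%:E = (expR (c ^+ 2 * s ^+ 2 /
    2))%:E)%E.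
Proof.
move=> s0; rewrite ge0_integral_normal_prob; last 2 first.
- by apply/measurable_EFinP; exact: measurableT_comp.
- by move=> y; rewrite lee_fin expR_ge0.
under eq_integral do rewrite -EFinM expR_normal_pdf// EFinM.
rewrite ge0_integralZl//; last 2 first.
- by apply/measurable_EFinP; exact: measurable_normal_pdf.
- by move=> y _; rewrite lee_fin normal_pdf_ge0.
by rewrite integral_normal_pdf mule1.
Qed.

End Gaussian.

Section RandomVariables.
Context {R : realType} {d : measure_display} {T : measurableType d}.
Variable Pr : probability T R.

Lemma integral_expR_normal (X : {RV Pr >-> R}) (s c : R) : s != 0 ->
  (forall B, measurable B -> distribution Pr X B = normal_prob 0 s B) ->
  (\int[Pr]_w (expR (c * X w))%:E = (expR (c ^+ 2 * s ^+ 2 / 2))%:E)%E.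
Proof.
move=> s0 dX; rewrite -(normal_prob_mgf c s0).
have me : measurable_fun setT (fun y : R => (expR (c * y))%:E).
  by apply/measurable_EFinP; exact: measurableT_comp.
(* [normal_prob] lives on [measurableTypeR R], whose measurable sets are those
   of [R] up to conversion only. *)
have mX : measurable_fun setT (X : T -> measurableTypeR R).
  by have := measurable_funPT X; exact.
pose mixin := isMeasurableFun.Build _ _ _ _ _ mX.
pose Y : {mfun T >-> measurableTypeR R} := HB.pack (X : T -> measurableTypeR
  R) mixin.
have -> : (\int[Pr]_w (expR (c * X w))%:E = \int[distribution Pr Y]_y (expR (c
  * y))%:E)%E.
  by rewrite ge0_integral_distribution// => y; rewrite lee_fin expR_ge0.
by apply: eq_measure_integral => A mA _; exact: dX.
Qed.

(** Independence on rectangles identifies the joint law with the product measure; Tonelli's theorem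
    then splits the integral. *)
Lemma independent_integralM (X Y : {RV Pr >-> R}) (f g : R -> \bar R) :
  (forall A B, measurable A -> measurable B ->
    Pr (X @^-1` A `&` Y @^-1` B) = (Pr (X @^-1` A) * Pr (Y @^-1` B))%E) ->
  measurable_fun setT f -> measurable_fun setT g ->
  (forall y, (0 <= f y)%E) -> (forall y, (0 <= g y)%E) ->
  (\int[Pr]_w (f (X w) * g (Y w)) =
   (\int[Pr]_w f (X w)) * (\int[Pr]_w g (Y w)))%E.
Proof.
move=> XY mf mg f0 g0.
pose phi w := (X w, Y w).
have mphi : measurable_fun setT phi by exact: measurable_fun_pair.
pose mphi_mixin := isMeasurableFun.Build _ _ _ _ _ mphi.
pose Z : {mfun T >-> (R * R)%type} := HB.pack phi mphi_mixin.
pose F (z : R * R) := (f z.1 * g z.2)%E.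
have mF : measurable_fun setT F.
  by apply: emeasurable_funM; apply: measurableT_comp.
have F0 z : (0 <= F z)%E by rewrite mule_ge0.
have -> : (\int[Pr]_w (f (X w) * g (Y w)) = \int[distribution Pr Z]_z F z)%E.
  by rewrite ge0_integral_distribution.
have -> : (\int[distribution Pr Z]_z F z =
    \int[distribution Pr X \x distribution Pr Y]_z F z)%E.
  apply: eq_measure_integral => A mA _; apply/esym.
  by apply: product_measure_unique => // B C mB mC; exact: XY.
rewrite fubini_tonelli1//.
under eq_integral => x _.
  rewrite /fubini_F/= /F/= ge0_integralZl//.
  over.
rewrite ge0_integralZr//; last by rewrite integral_ge0.
by rewrite !ge0_integral_distribution.
Qed.

End RandomVariables.

Section Mean.
Context {R : realType} {d : measure_display} {T : measurableType d}.
Variable Pr : probability T R.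
Implicit Types f g : T -> R.

Definition summable_rv f := Pr.-integrable setT (EFin \o f).
(** A real-valued expectation keeps the estimates in linear arithmetic; it is meaningful together
    with [summable_rv]. *)
Definition mean f : R := \int[Pr]_w f w.

Lemma EFin_mean f : summable_rv f -> (mean f)%:E = (\int[Pr]_w (f w)%:E)%E.
Proof. by move=> sf; rewrite fineK// integrable_fin_num. Qed.

Lemma summable_rv_measurable f : summable_rv f -> measurable_fun setT f.
Proof. by move=> /integrableP[/measurable_EFinP]. Qed.

Lemma summable_rv_le f g : measurable_fun setT f -> (forall w, `|f w| <= g w) ->
  summable_rv g -> summable_rv f.
Proof.
move=> mf fg sg; apply: (le_integrable measurableT _ _ sg).
  exact/measurable_EFinP.
by move=> w _; rewrite /= lee_fin (le_trans (fg w))// ler_norm.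
Qed.

Lemma summable_rv_cst c : summable_rv (fun=> c).
Proof. exact: finite_measure_integrable_cst. Qed.

Lemma summable_rvD f g : summable_rv f -> summable_rv g ->
  summable_rv (fun w => f w + g w).
Proof. by move=> sf sg; exact: (integrableD measurableT sf sg). Qed.

Lemma summable_rvZ c f : summable_rv f -> summable_rv (fun w => c * f w).
Proof. by move=> sf; exact: (integrableZl measurableT c sf). Qed.

Lemma summable_rv_sum (I : finType) (f : I -> T -> R) :
  (forall i, summable_rv (f i)) -> summable_rv (fun w => \sum_i f i w).
Proof.
move=> sf; elim: (index_enum I) => [|i s IH].
  by under [X in summable_rv X]funext do rewrite big_nil;
    exact: summable_rv_cst.
by under [X in summable_rv X]funext do rewrite big_cons; exact: summable_rvD.
Qed.

Lemma mean_cst c : mean (fun=> c) = c.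
Proof.
by rewrite /mean /Rintegral integral_cst//= probability_setT mule1.
Qed.

Lemma meanD f g : summable_rv f -> summable_rv g ->
  mean (fun w => f w + g w) = mean f + mean g.
Proof. by move=> sf sg; exact: RintegralD. Qed.

Lemma meanZ c f : summable_rv f -> mean (fun w => c * f w) = c * mean f.
Proof. by move=> sf; exact: RintegralZl. Qed.

Lemma mean_le f g : summable_rv f -> summable_rv g ->
  (forall w, f w <= g w) -> mean f <= mean g.
Proof. by move=> sf sg fg; apply: le_Rintegral. Qed.

Lemma mean_sum (I : finType) (f : I -> T -> R) :
  (forall i, summable_rv (f i)) ->
  mean (fun w => \sum_i f i w) = \sum_i mean (f i).
Proof.
move=> sf; suff [] : summable_rv (fun w => \sum_i f i w) /\
  mean (fun w => \sum_i f i w) = \sum_i mean (f i) by [].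
elim: (index_enum I) => [|i s [sIH IH]].
  under [X in summable_rv X]funext do rewrite big_nil.
  under [X in mean X]funext do rewrite big_nil.
  by rewrite big_nil mean_cst; split => //; exact: summable_rv_cst.
under [X in summable_rv X]funext do rewrite big_cons.
under [X in mean X]funext do rewrite big_cons.
by rewrite big_cons meanD// IH; split => //; exact: summable_rvD.
Qed.

End Mean.

Section FiniteSums.
Context {R : realType} {I : finType}.
Implicit Types A : I -> R.

Lemma sum_powR_gt0 A u i : 0 < A i -> 0 < \sum_j A j `^ u.
Proof.
move=> Ai; rewrite (bigD1 i)//= ltr_pwDl ?powR_gt0// sumr_ge0// => j _.
exact: powR_ge0.
Qed.

(** After division by the total S each ratio lies in [0, 1], where a power u <= 1 does not decrease
    it. *)
Lemma ln_sum_powR_subadd A u : (forall i, 0 <= A i) -> 0 < \sum_i A i ->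
  0 < u -> u <= 1 -> u * ln (\sum_i A i) <= ln (\sum_i A i `^ u).
Proof.
move=> A0 S0 u0 u1; set S := \sum_i A i in S0 *.
have Su0 : 0 < S `^ u by rewrite powR_gt0.
rewrite -ln_powR ler_ln ?posrE//.
  suff : 1 <= \sum_i (A i / S) `^ u.
    have -> : \sum_i (A i / S) `^ u = (\sum_i A i `^ u) / S `^ u.
      rewrite mulr_suml; apply: eq_bigr => i _.
      by rewrite powRM ?invr_ge0 ?(ltW S0)// -powR_inv1 ?(ltW S0)// powRAC
        powR_inv1 ?powR_ge0.
    by rewrite ler_pdivlMr// mul1r.
  rewrite -[leLHS](divff (lt0r_neq0 S0)) {1}/S mulr_suml.
  apply: ler_sum => i _.
  have AS0 : 0 <= A i / S by rewrite divr_ge0// ltW.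
  have AS1 : A i / S <= 1.
    by rewrite ler_pdivrMr// mul1r /S (bigD1 i)//= lerDl sumr_ge0.
  have [->|N0] := eqVneq (A i / S) 0; first exact: powR_ge0.
  have AS : 0 < A i / S by rewrite lt_def N0.
  rewrite /powR (negbTE N0) -{1}[A i / S]lnK ?posrE// ler_expR.
  by have := ln_le0 AS1; nra.
have [i Ai] : exists i, 0 < A i.
  apply/not_existsP => h; move: S0; rewrite /S big1 ?ltxx// => i _.
  by apply/le_anti; rewrite A0 andbT leNgt; apply/negP/h.
exact: sum_powR_gt0 Ai.
Qed.

Lemma expR_convex (k a c : R) : 0 <= k -> k <= 1 ->
  expR ((1 - k) * a + k * c) <= (1 - k) * expR a + k * expR c.
Proof.
move=> k0 k1; set m := (1 - k) * a + k * c.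
have -> : (1 - k) * expR a + k * expR c =
    expR m * ((1 - k) * expR (a - m) + k * expR (c - m)).
  rewrite !expRB; have := lt0r_neq0 (expR_gt0 m) => m0.
  by field.
rewrite ler_peMr ?expR_ge0//.
have h1 : (1 - k) * (1 + (a - m)) <= (1 - k) * expR (a - m).
  by rewrite ler_wpM2l ?expR_ge1Dx//; lra.
have h2 : k * (1 + (c - m)) <= k * expR (c - m).
  by rewrite ler_wpM2l ?expR_ge1Dx.
by rewrite (le_trans _ (lerD h1 h2))// /m; lra.
Qed.

(** Hölder's inequality: once the two sums on the right are normalized to 1, convexity of the
    exponential applies term by term. *)
Lemma ln_sum_powR_convex A i0 u u' u'' k : (forall i, 0 <= A i) -> 0 < A i0 ->
  0 < u -> 0 < u' -> 0 < u'' -> 0 <= k -> k <= 1 ->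
  u = (1 - k) * u' + k * u'' ->
  ln (\sum_i A i `^ u) <=
  (1 - k) * ln (\sum_i A i `^ u') + k * ln (\sum_i A i `^ u'').
Proof.
move=> A0 Ai0 u0 u'0 u''0 k0 k1 uE.
have X0 := sum_powR_gt0 u' Ai0; have Y0 := sum_powR_gt0 u'' Ai0.
have U0 := sum_powR_gt0 u Ai0.
have [F' eF'] : exists F', \sum_i A i `^ u' = expR F'.
  by exists (ln (\sum_i A i `^ u')); rewrite lnK ?posrE.
have [F'' eF''] : exists F'', \sum_i A i `^ u'' = expR F''.
  by exists (ln (\sum_i A i `^ u'')); rewrite lnK ?posrE.
rewrite -ler_expR lnK ?posrE// eF' eF'' !expRK.
set m := _ + _; rewrite -[leRHS]mul1r -ler_pdivrMr ?expR_gt0//.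
apply: (@le_trans _ _ (\sum_i ((1 - k) * (A i `^ u' / expR F') +
    k * (A i `^ u'' / expR F'')))); last first.
  rewrite big_split/= -!mulr_sumr -!mulr_suml eF' eF''.
  by rewrite !divff ?gt_eqF ?expR_gt0//; lra.
rewrite mulr_suml; apply: ler_sum => i _.
have [Ai|N0] := eqVneq (A i) 0.
  by rewrite Ai !powR0 ?gt_eqF// !mul0r !mulr0 addr0.
rewrite /powR (negbTE N0) -!expRB.
have -> : u * ln (A i) - m = (1 - k) * (u' * ln (A i) - F') + k * (u'' * ln (A
  i) - F'').
  by rewrite uE /m; ring.
exact: expR_convex.
Qed.

(** This and the next lemma are the two sides of truncation at 1: the second moment of what is kept
    and the size of what is lost. *)
Lemma minr1_sqr_le_powR (a p : R) : 0 <= a -> 1 < p -> p <= 2 ->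
  Num.min a 1 ^+ 2 <= a `^ p.
Proof.
move=> a0 p1 p2; have [a1|a1] := leP a 1; last first.
  rewrite expr1n -(powRr0 a) ler_powR ?(ltW a1)//; lra.
have [->|N0] := eqVneq a 0; first by rewrite expr0n/= powR_ge0.
have a0' : 0 < a by rewrite lt_def N0.
rewrite -powR_mulrn// /powR (negbTE N0) ler_expR.
by have := ln_le0 a1; nra.
Qed.

Lemma subr_minr1_le_powR (a p : R) : 0 <= a -> 1 < p ->
  a - Num.min a 1 <= a `^ p.
Proof.
move=> a0 p1; have [a1|a1] := leP a 1; first by rewrite subrr powR_ge0.
rewrite (@le_trans _ _ (a `^ 1))//; last by rewrite ler_powR ?ltW.
by rewrite powRr1//; lra.
Qed.

End FiniteSums.

(** * Bounds at finite N *)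

Section RandomPartition.
Context {R : realType} {d : measure_display} {T : measurableType d}.
Variables (Pr : probability T R) (I : finType) (W : I -> R).
Variables (x : I -> {RV Pr >-> R}) (v b : R) (i0 : I).
Hypotheses (W0 : forall i, 0 <= W i) (Wi0 : 0 < W i0).
Hypotheses (v0 : 0 < v) (b0 : 0 < b) (xN : iid_normal v x).

Local Notation summable := (summable_rv Pr).
Local Notation mean := (mean Pr).

Definition tilted i w := W i * expR (b * x i w).
Definition Zsum u w := \sum_i tilted i w `^ u.
Definition Zmean u := (\sum_i W i `^ u) * expR ((u * b) ^+ 2 * v / 2).
Local Notation A := tilted.

Let A_ge0 i w : 0 <= A i w.
Proof. by rewrite mulr_ge0 ?expR_ge0. Qed.

Let A_gt0 w : 0 < A i0 w.
Proof. by rewrite mulr_gt0 ?expR_gt0. Qed.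

Let A_powR i w u : A i w `^ u = W i `^ u * expR (u * b * x i w).
Proof. by rewrite powRM ?expR_ge0// -expRM; congr (_ * expR _); ring. Qed.

Lemma Zsum_gt0 u w : 0 < Zsum u w.
Proof. exact: sum_powR_gt0 (A_gt0 w). Qed.

Lemma Zmean_gt0 u : 0 < Zmean u.
Proof. by rewrite mulr_gt0 ?expR_gt0//; exact: sum_powR_gt0 Wi0. Qed.

Let mx i : measurable_fun setT (x i).
Proof. exact: measurable_funPT. Qed.

Let mexp i c : measurable_fun setT (fun w => expR (c * x i w)).
Proof. by apply: measurableT_comp => //; exact: measurable_funM. Qed.

Let int_exp i c : (\int[Pr]_w (expR (c * x i w))%:E = (expR (c ^+ 2 * v /
  2))%:E)%E.
Proof.
have s0 : Num.sqrt v != 0 by rewrite gt_eqF// sqrtr_gt0.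
by rewrite (integral_expR_normal c s0 (xN.2 i)) sqr_sqrtr// ltW.
Qed.

Let summable_exp i c : summable (fun w => expR (c * x i w)).
Proof.
apply/integrableP; split; first exact/measurable_EFinP.
under eq_integral do rewrite /= ger0_norm ?expR_ge0//.
by rewrite int_exp ltry.
Qed.

Let mean_exp i c : mean (fun w => expR (c * x i w)) = expR (c ^+ 2 * v / 2).
Proof. by rewrite /mean /Rintegral int_exp. Qed.

Let summable_A i u : summable (fun w => A i w `^ u).
Proof.
under [X in summable X]funext do rewrite A_powR.
exact: summable_rvZ.
Qed.

Let mean_A i u : mean (fun w => A i w `^ u) = W i `^ u * expR ((u * b) ^+ 2 *
  v / 2).
Proof.
under [X in mean X]funext do rewrite A_powR.
by rewrite meanZ// mean_exp.
Qed.

Lemma summable_Zsum u : summable (Zsum u).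
Proof. by apply: summable_rv_sum. Qed.

Lemma mean_Zsum u : mean (Zsum u) = Zmean u.
Proof.
rewrite mean_sum//; under eq_bigr do rewrite mean_A.
by rewrite -mulr_suml.
Qed.

(** Reduces first absolute moments to exponential moments; scaling by the standard deviation keeps
    the bound of order sqrt v. *)
Let normr_le_exp i w :
  `|x i w| <= Num.sqrt v * (expR ((Num.sqrt v)^-1 * x i w) + expR (- (Num.sqrt
    v)^-1 * x i w)).
Proof.
have s0 : 0 < Num.sqrt v by rewrite sqrtr_gt0.
rewrite -ler_pdivrMl// -[X in X * `|_|]gtr0_norm ?invr_gt0// -normrM mulNr.
set y := _ * x i w; rewrite ler_norml.
have := expR_ge1Dx y; have := expR_ge1Dx (- y).
have := expR_gt0 y; have := expR_gt0 (- y).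
by move=> *; apply/andP; split; lra.
Qed.

Lemma summable_normr i : summable (fun w => `|x i w|).
Proof.
apply: (@summable_rv_le _ _ _ _ _ (fun w => Num.sqrt v *
  (expR ((Num.sqrt v)^-1 * x i w) + expR (- (Num.sqrt v)^-1 * x i w)))).
- exact: measurableT_comp.
- by move=> w; rewrite normr_id normr_le_exp.
- by apply: summable_rvZ; exact: summable_rvD.
Qed.

Lemma mean_normr i : mean (fun w => `|x i w|) <= 4 * Num.sqrt v.
Proof.
have s0 : 0 < Num.sqrt v by rewrite sqrtr_gt0.
have e0 : (Num.sqrt v)^-1 ^+ 2 * v / 2 = 2^-1.
  by rewrite exprVn sqr_sqrtr ?ltW// mulVf ?gt_eqF// mul1r.
apply: le_trans (mean_le (summable_normr i) _ (normr_le_exp i)) _.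
  by apply: summable_rvZ; exact: summable_rvD.
rewrite meanZ; last exact: summable_rvD.
rewrite meanD// !mean_exp sqrrN e0 mulrC ler_pM2r//.
suff : expR (2^-1) <= 2 :> R by lra.
have := @expR_le_quad R 2^-1 (lexx _); lra.
Qed.

(** Keeps the single summand [i0]. This crude bound gives integrability of the logarithm and handles
    the exceptional event. *)
Let ln_Zsum_ge u w : u * ln (W i0) - `|u * b| * `|x i0 w| <= ln (Zsum u w).
Proof.
apply: (@le_trans _ _ (ln (A i0 w `^ u))); last first.
  rewrite ler_ln ?posrE ?Zsum_gt0 ?powR_gt0//.
  by rewrite /Zsum (bigD1 i0)//= lerDl sumr_ge0// => j _; exact: powR_ge0.
rewrite ln_powR lnM ?posrE ?expR_gt0// expRK mulrDr lerD2l mulrA -normrM.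
by have := ler_norm (- (u * b * x i0 w)); rewrite normrN; lra.
Qed.

(** The tangent of ln at m: m = 1 serves integrability, and m = [Zmean u] yields Jensen's inequality
    after integration. *)
Let ln_Zsum_le u w m : 0 < m -> ln (Zsum u w) <= ln m + (m^-1 * Zsum u w - 1).
Proof.
move=> m0; have Z0 := Zsum_gt0 u w.
have -> : ln (Zsum u w) = ln m + ln (m^-1 * Zsum u w).
  by rewrite -lnM ?posrE ?mulr_gt0 ?invr_gt0// mulrA divff ?mul1r// gt_eqF.
rewrite lerD2l; have := @le_ln1Dx R (m^-1 * Zsum u w - 1).
rewrite [1 + _]addrC subrK; apply.
by rewrite ltrBrDl subrr mulr_gt0// invr_gt0.
Qed.

Lemma measurable_ln_Zsum u : measurable_fun setT (fun w => ln (Zsum u w)).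
Proof.
by apply: measurableT_comp => //; exact: summable_rv_measurable (summable_Zsum
  u).
Qed.

Lemma summable_ln_Zsum u : summable (fun w => ln (Zsum u w)).
Proof.
pose g w := (Zsum u w + `|u * b| * `|x i0 w|) + `|u * ln (W i0)|.
apply: (@summable_rv_le _ _ _ _ _ g); first exact: measurable_ln_Zsum.
  move=> w; have := ln_Zsum_ge u w; have := ln_Zsum_le u w ltr01.
  rewrite ln1 invr1 mul1r /g; have := Zsum_gt0 u w.
  have := ler_norm (- (u * ln (W i0))); rewrite normrN.
  have : 0 <= `|u * b| * `|x i0 w| by rewrite mulr_ge0.
  have := normr_ge0 (u * ln (W i0)).
  by move=> *; rewrite ler_norml; apply/andP; split; lra.
apply: summable_rvD; last exact: summable_rv_cst.
apply: summable_rvD; first exact: summable_Zsum.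
by apply: summable_rvZ; exact: summable_normr.
Qed.

Lemma mean_ln_Zsum_le u : mean (fun w => ln (Zsum u w)) <= ln (Zmean u).
Proof.
have m0 := Zmean_gt0 u.
have sZ := summable_rvZ (Zmean u)^-1 (summable_Zsum u).
have sc c := @summable_rv_cst _ _ _ Pr c.
have sZ1 := summable_rvD sZ (sc (-1)).
apply: le_trans (mean_le (summable_ln_Zsum u) _ (fun w => ln_Zsum_le u w m0)) _.
  exact: (summable_rvD (sc (ln (Zmean u))) sZ1).
rewrite (meanD (sc _) sZ1) (meanD sZ (sc _)) !mean_cst (meanZ _ (summable_Zsum
  u)).
by rewrite mean_Zsum mulVf ?gt_eqF//; lra.
Qed.

Lemma mean_ln_Zsum1_le u : 0 < u -> u <= 1 ->
  mean (fun w => ln (Zsum 1 w)) <= u^-1 * ln (Zmean u).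
Proof.
move=> u0 u1; rewrite ler_pdivlMl// -meanZ; last exact: summable_ln_Zsum.
apply: le_trans (mean_ln_Zsum_le u).
apply: mean_le => [||w]; [|exact: summable_ln_Zsum|].
  by apply: summable_rvZ; exact: summable_ln_Zsum.
rewrite {1}/Zsum; under eq_bigr do rewrite powRr1//.
apply: ln_sum_powR_subadd => //; have := Zsum_gt0 1 w.
by rewrite /Zsum; under eq_bigr do rewrite powRr1//.
Qed.

Lemma mean_ln_Zsum_convex u u' k : 0 < u -> 0 < u' -> 0 <= k -> k <= 1 ->
  u = (1 - k) * u' + k ->
  mean (fun w => ln (Zsum u w)) <=
  (1 - k) * mean (fun w => ln (Zsum u' w)) + k * mean (fun w => ln (Zsum 1 w)).
Proof.
move=> u0 u'0 k0 k1 uE.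
have s := summable_ln_Zsum.
rewrite -!meanZ// -meanD; [|exact: summable_rvZ..].
apply: mean_le => [//||w]; first by apply: summable_rvD; exact: summable_rvZ.
by apply: (@ln_sum_powR_convex _ _ _ i0); rewrite ?mulr1.
Qed.

(** Jensen's inequality for the weights W_i: ln Z_1 is at least the W-average of b x_i. The loss of
    order sqrt v is negligible against N, which settles the case V <= 0. *)
Lemma mean_ln_Zsum1_ge : \sum_i W i = 1 ->
  - (4 * b * Num.sqrt v) <= mean (fun w => ln (Zsum 1 w)).
Proof.
move=> W1.
pose g w := \sum_i (- (W i * b)) * `|x i w|.
have sg : summable g.
  by apply: summable_rv_sum => i; apply: summable_rvZ; exact: summable_normr.
apply: (@le_trans _ _ (mean g)).
  rewrite mean_sum; last by move=> i; apply: summable_rvZ;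
    exact: summable_normr.
  have -> : - (4 * b * Num.sqrt v) = \sum_i W i * - (4 * b * Num.sqrt v).
    by rewrite -mulr_suml W1 mul1r.
  apply: ler_sum => i _.
  rewrite meanZ; last exact: summable_normr.
  have : W i * b * mean (fun w => `|x i w|) <= W i * b * (4 * Num.sqrt v).
    by rewrite ler_wpM2l ?mean_normr// mulr_ge0// ltW.
    by lra.
apply: mean_le => // [|w]; first exact: summable_ln_Zsum.
apply: (@le_trans _ _ (\sum_i W i * (b * x i w))).
  apply: ler_sum => i _; have : W i * b * (- x i w) <= W i * b * `|x i w|.
    by rewrite ler_wpM2l ?mulr_ge0 ?(ltW b0)// -normrN ler_norm.
  by lra.
set a := \sum_i _; rewrite -ler_expR lnK ?posrE ?Zsum_gt0//.
have -> : Zsum 1 w = expR a * \sum_i W i * expR (b * x i w - a).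
  rewrite mulr_sumr; apply: eq_bigr => i _; rewrite powRr1//.
  by rewrite mulrCA -expRD addrC subrK.
rewrite ler_peMr ?expR_ge0//.
apply: (@le_trans _ _ (\sum_i W i * (1 + (b * x i w - a)))).
  have -> : \sum_i W i * (1 + (b * x i w - a)) = (1 - a) * \sum_i W i + a.
    by rewrite mulr_sumr -big_split/=; apply: eq_bigr => i _; ring.
  by rewrite W1; lra.
by apply: ler_sum => i _; rewrite ler_wpM2l// expR_ge1Dx.
Qed.

Let pairwise_independent i j : i != j -> forall B C, measurable B ->
  measurable C ->
  Pr (x i @^-1` B `&` x j @^-1` C) = (Pr (x i @^-1` B) * Pr (x j @^-1` C))%E.
Proof.
move=> ij B C mB mC; pose D k := if k == i then B else C.
have mD k : measurable (D k) by rewrite /D; case: ifP.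
have := xN.1 [set i; j]%SET D mD.
rewrite big_setU1 ?inE//= big_set1 {2 3}/D eqxx eq_sym (negbTE ij) => <-.
congr (Pr _); apply/seteqP; split=> w /=.
  move=> [xB xC] k; rewrite /= !inE => /orP[]/eqP ->; rewrite /D ?eqxx//.
  by rewrite eq_sym (negbTE ij).
move=> h; split; first by have := h i; rewrite /= /D !inE eqxx; apply.
by have := h j; rewrite /= /D !inE eqxx orbT eq_sym (negbTE ij); apply.
Qed.

Section HighTemperature.
Variables (u p : R).
Hypotheses (p1 : 1 < p) (p2 : p <= 2).

Let m := Zmean u.
(** The total p-th moment of the normalized summands [al], whose means add up to 1. *)
Let eps := Zmean (p * u) / m `^ p.
Let al i w := m^-1 * A i w `^ u.
(** The truncated summand as a function of the value of [x i] alone, the form in which independence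
    applies. *)
Let fb i (y : R) := Num.min (m^-1 * (W i `^ u * expR (u * b * y))) 1.
Let bt i w := fb i (x i w).
Let e i := mean (bt i).

Let m0 : 0 < m. Proof. exact: Zmean_gt0. Qed.

Let al_ge0 i w : 0 <= al i w.
Proof. by rewrite mulr_ge0 ?invr_ge0 ?(ltW m0)// powR_ge0. Qed.

Let btE i w : bt i w = Num.min (al i w) 1.
Proof. by rewrite /bt /fb /al A_powR. Qed.

Let fb_ge0 i y : 0 <= fb i y.
Proof.
by rewrite le_min ler01 andbT !mulr_ge0 ?invr_ge0 ?(ltW m0)// ?powR_ge0
  ?expR_ge0.
Qed.

Let fb_le1 i y : fb i y <= 1.
Proof. by rewrite ge_min lexx orbT. Qed.

Let measurable_fb i : measurable_fun setT (fb i).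
Proof.
apply: measurable_minr => //; apply: measurable_funM => //.
apply: measurable_funM => //; apply: measurableT_comp => //.
Qed.

Let measurable_bt i : measurable_fun setT (bt i).
Proof. exact: measurableT_comp. Qed.

Let summable_al i : summable (al i).
Proof. exact: summable_rvZ. Qed.

Let al_powR i w : al i w `^ p = (m `^ p)^-1 * A i w `^ (p * u).
Proof.
rewrite powRM ?powR_ge0 ?invr_ge0 ?(ltW m0)// -powRrM [u * p]mulrC.
by rewrite -powR_inv1 ?(ltW m0)// powRAC powR_inv1 ?powR_ge0.
Qed.

Let summable_al_powR i : summable (fun w => al i w `^ p).
Proof.
under [X in summable X]funext do rewrite al_powR.
exact: summable_rvZ.
Qed.

Let sum_mean_al : \sum_i mean (al i) = 1.
Proof.
under eq_bigr do rewrite meanZ// mean_A.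
by rewrite -mulr_sumr -mulr_suml -/(Zmean u) -/m mulVf// gt_eqF.
Qed.

Let sum_mean_al_powR : \sum_i mean (fun w => al i w `^ p) = eps.
Proof.
rewrite /eps -(mean_Zsum (p * u)) mulrC -meanZ; last exact: summable_Zsum.
rewrite -mean_sum//; congr (mean _); apply/funext => w.
by rewrite /Zsum mulr_sumr; apply: eq_bigr => i _; exact: al_powR.
Qed.

Let summable_bounded (f : T -> R) : measurable_fun setT f -> (forall w, 0 <= f
  w <= 1) ->
  summable f.
Proof.
move=> mf f01; apply: (@summable_rv_le _ _ _ _ _ (fun=> 1)) => // [w|].
  by have /andP[f0 f1] := f01 w; rewrite ger0_norm.
exact: summable_rv_cst.
Qed.

Let summable_bt i : summable (bt i).
Proof. by apply: summable_bounded => // w; rewrite fb_ge0 fb_le1. Qed.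

Let summable_btM i j : summable (fun w => bt i w * bt j w).
Proof.
apply: summable_bounded => [|w]; first exact: measurable_funM.
by rewrite mulr_ge0 ?fb_ge0//= mulr_ile1 ?fb_ge0 ?fb_le1.
Qed.

Let sum_e_ge : 1 - eps <= \sum_i e i.
Proof.
rewrite -sum_mean_al -sum_mean_al_powR -sumrB; apply: ler_sum => i _.
rewrite lerBlDr -(meanD (summable_bt i) (summable_al_powR i)).
apply: mean_le => // [|w]; first exact: summable_rvD.
by rewrite -lerBlDl btE subr_minr1_le_powR.
Qed.

Let mean_btM i j : i != j -> mean (fun w => bt i w * bt j w) = e i * e j.
Proof.
move=> ij; have fin k : (\int[Pr]_w (bt k w)%:E)%E \is a fin_num.
  exact: integrable_fin_num (summable_bt k).
rewrite /e /mean /Rintegral -fineM//; congr fine.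
 rewrite -(independent_integralM (pairwise_independent ij)
  (f := EFin \o fb i) (g := EFin \o fb j))//.
- exact/measurable_EFinP.
- exact/measurable_EFinP.
- by move=> y; rewrite lee_fin.
- by move=> y; rewrite lee_fin.
Qed.

(** Off the diagonal the means factorize; the diagonal terms cost at most the p-th moments, so the
    variance of [sum_bt] is at most [eps]. *)
Let mean_btM_le i j : mean (fun w => bt i w * bt j w) <=
  e i * e j + (if j == i then mean (fun w => al i w `^ p) else 0).
Proof.
have [->|ij] := eqVneq j i; last by rewrite addr0 mean_btM// eq_sym.
rewrite (@le_trans _ _ (mean (fun w => al i w `^ p)))//; last first.
  have e0 k : 0 <= e k by apply: Rintegral_ge0 => w _; exact: fb_ge0.
  by rewrite lerDr mulr_ge0.
by apply: mean_le => // w; rewrite -expr2 btE minr1_sqr_le_powR.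
Qed.

Let sum_bt w := \sum_i bt i w.

Let summable_sum_bt : summable sum_bt.
Proof. exact: summable_rv_sum. Qed.

Let sum_bt_sqr w : sum_bt w ^+ 2 = \sum_i \sum_j bt i w * bt j w.
Proof.
by rewrite expr2 mulr_suml; apply: eq_bigr => i _; rewrite mulr_sumr.
Qed.

Let summable_sum_bt_sqr : summable (fun w => sum_bt w ^+ 2).
Proof.
under [X in summable X]funext do rewrite sum_bt_sqr.
by apply: summable_rv_sum => i; exact: summable_rv_sum.
Qed.

Let mean_sum_bt_sqr : mean (fun w => sum_bt w ^+ 2) <= (\sum_i e i) ^+ 2 + eps.
Proof.
under [X in mean X]funext do rewrite sum_bt_sqr.
rewrite mean_sum; last by move=> i; exact: summable_rv_sum.
apply: (@le_trans _ _ (\sum_i \sum_j (e i * e j +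
    (if j == i then mean (fun w => al i w `^ p) else 0)))).
  by apply: ler_sum => i _; rewrite mean_sum//; apply: ler_sum.
under eq_bigr do rewrite big_split/= -big_mkcond/= big_pred1_eq.
rewrite big_split/= sum_mean_al_powR lerD2r expr2 mulr_suml.
by apply: ler_sum => i _; rewrite mulr_sumr.
Qed.

Let centered_sqr w : (sum_bt w - \sum_i e i) ^+ 2 =
  sum_bt w ^+ 2 + ((- 2 * \sum_i e i) * sum_bt w + (\sum_i e i) ^+ 2).
Proof. by ring. Qed.

Let summable_centered_sqr : summable (fun w => (sum_bt w - \sum_i e i) ^+ 2).
Proof.
under [X in summable X]funext do rewrite centered_sqr.
apply: summable_rvD => //; apply: summable_rvD; last exact: summable_rv_cst.
exact: summable_rvZ.
Qed.

Let mean_centered_sqr : mean (fun w => (sum_bt w - \sum_i e i) ^+ 2) <= eps.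
Proof.
have s1 := summable_rvZ (- 2 * \sum_i e i) summable_sum_bt.
have s2 := @summable_rv_cst _ _ _ Pr ((\sum_i e i) ^+ 2).
under [X in mean X]funext do rewrite centered_sqr.
rewrite meanD//; last exact: (summable_rvD s1 s2).
rewrite (meanD s1 s2) meanZ// mean_cst mean_sum// -/e.
have := mean_sum_bt_sqr; nra.
Qed.

(* A truncated second moment argument: [sum_bt] concentrates around its mean,
   which is close to 1, and [Zsum u / m] dominates it; on the exceptional event
   [Zsum u] is bounded below by its single term [i0]. *)
Lemma mean_ln_Zsum_ge L : eps <= 4^-1 -> 0 <= L -> ln m - u * ln (W i0) <= L ->
  ln m - (ln 4 + 4 * L * eps + `|u * b| * (4 * Num.sqrt v)) <=
  mean (fun w => ln (Zsum u w)).
Proof.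
move=> eps4 L0 mL.
(* One minorant for both events. If [sum_bt] <= 1/4, its mean is at least 3/4, so the squared
   deviation is at least 1/4 and the factor 4 L subtracts at least L. Otherwise [Zsum u] >= m /
   4. *)
pose g w := (ln m - ln 4) + ((- (4 * L)) * (sum_bt w - \sum_i e i) ^+ 2 +
   (- `|u * b|) * `|x i0 w|).
have sc := @summable_rv_cst _ _ _ Pr (ln m - ln 4).
have s1 := summable_rvZ (- (4 * L)) summable_centered_sqr.
have s2 := summable_rvZ (- `|u * b|) (summable_normr i0).
have s12 := summable_rvD s1 s2.
have sg : summable g := summable_rvD sc s12.
apply: (@le_trans _ _ (mean g)).
  rewrite (meanD sc s12) (meanD s1 s2) mean_cst !meanZ//;
    last exact: summable_normr.
  have h1 : 4 * L * mean (fun w => (sum_bt w - \sum_i e i) ^+ 2) <= 4 * L * eps.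
    by rewrite ler_wpM2l// mulr_ge0.
  have h2 : `|u * b| * mean (fun w => `|x i0 w|) <= `|u * b| * (4 * Num.sqrt v).
    by rewrite ler_wpM2l// mean_normr.
  by lra.
apply: mean_le => // [|w]; first exact: summable_ln_Zsum.
have ln4 : 0 <= ln 4 :> R by rewrite ln_ge0// ler1n.
have ux0 : 0 <= `|u * b| * `|x i0 w| by rewrite mulr_ge0.
have q0 : 0 <= 4 * L * (sum_bt w - \sum_i e i) ^+ 2.
  by rewrite mulr_ge0 ?sqr_ge0// mulr_ge0.
rewrite /g; have [B4|B4] := leP (sum_bt w) 4^-1.
  have := ln_Zsum_ge u w.
  have : 4 * L * 4^-1 <= 4 * L * (sum_bt w - \sum_i e i) ^+ 2.
    by rewrite ler_wpM2l ?mulr_ge0//; have := sum_e_ge; nra.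
  by lra.
have bZ : sum_bt w <= m^-1 * Zsum u w.
  rewrite /Zsum mulr_sumr; apply: ler_sum => i _.
  by rewrite btE ge_min lexx.
have m4 : 0 < m / 4 by rewrite divr_gt0.
have : ln (m / 4) <= ln (Zsum u w).
  rewrite ler_ln ?posrE ?Zsum_gt0//.
  by rewrite -ler_pdivlMl// (le_trans (ltW B4)).
by rewrite ln_div ?posrE//; lra.
Qed.

End HighTemperature.

End RandomPartition.

(** * Asymptotics of the free energy *)

Section FreeEnergy.
Context {R : realType} {M : nat}.
Variables (P : 'M[R]_M) (pi : 'rV[R]_M) (b : R).
Variables (d : nat -> measure_display) (T : forall N, measurableType (d N)).
Variables (Pr : forall N, probability (T N) R).
Variable x : forall N, N.-tuple 'I_M -> {RV (Pr N) >-> R}.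
Hypotheses (M0 : (0 < M)%N) (sP : stochastic P) (irrP : irreducible P).
Hypotheses (pi0 : forall i, 0 <= pi 0 i) (pi1 : \sum_i pi 0 i = 1).
Hypotheses (b0 : 0 < b).
Hypothesis xN : forall N : nat, (0 < N)%N -> iid_normal N%:R (x (N := N)).

Local Notation ell := (log_lambda P).
Local Notation h := (gauss_pressure ell b).

Let W N (s : N.-tuple 'I_M) : R := path_prob pi P s.

Definition mean_log_Z N u : R :=
  mean (Pr N) (fun w => ln (Zsum (@W N) (x (N := N)) b u w)).
Local Notation F := mean_log_Z.

Let W0 N (s : N.-tuple 'I_M) : 0 <= W s.
Proof. by apply: path_prob_ge0 => //; case: sP. Qed.

Let likely N : (0 < N)%N -> exists s : N.-tuple 'I_M,
  - (N%:R * ln M%:R) <= ln (W s) /\ 0 < W s.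
Proof. exact: exists_likely_path. Qed.

Let natr_gt0 N : (0 < N)%N -> 0 < N%:R :> R.
Proof. by rewrite ltr0n. Qed.

Let sqrt_natr_ge1 N : (0 < N)%N -> 1 <= Num.sqrt N%:R :> R.
Proof.
by move=> N0; rewrite -[leLHS]sqrtr1; apply: ler_wsqrtr; rewrite ler1n.
Qed.

Lemma sqrt_natr_sublinear (c e : R) : 0 < e ->
  \forall N \near \oo, c * Num.sqrt N%:R <= e * N%:R.
Proof.
move=> e0; near=> N.
have cN : (c / e) ^+ 2 <= N%:R by near: N; exact: nbhs_infty_ger.
have [c0|c0] := leP c 0.
  by rewrite (@le_trans _ _ 0)// ?mulr_le0_ge0// mulr_ge0// ltW.
rewrite -{2}[N%:R]sqr_sqrtr// expr2 mulrA ler_wpM2r// -ler_pdivrMl//.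
rewrite mulrC -[leLHS]gtr0_norm ?divr_gt0// -sqrtr_sqr ler_wsqrtr//.
Unshelve. all: by end_near. Qed.

Lemma ln_Zmean_asymp u : 0 < u -> exists c, 0 <= c /\ forall N, (0 < N)%N ->
  `|ln (Zmean (@W N) N%:R b u) - N%:R * h u| <= c.
Proof.
move=> u0; have [c cS] := ln_sum_path_powR M0 sP irrP pi0 pi1 u0.
exists c; split; first by have [_] := cS 1%N isT; exact: le_trans.
move=> N N0; have [S0 Sc] := cS N N0.
rewrite /Zmean lnM ?posrE ?expR_gt0// expRK /gauss_pressure.
rewrite (le_trans _ Sc)// le_eqVlt; apply/orP; left; apply/eqP; congr `|_|.
by rewrite /W; field.
Qed.

Lemma mean_log_Z_le u : 0 < u -> exists c, 0 <= c /\
  forall N, (0 < N)%N -> F N u <= N%:R * h u + c.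
Proof.
move=> u0; have [c [c0 cZ]] := ln_Zmean_asymp u0; exists c; split => // N N0.
have [s [_ Ws]] := likely N0.
have := cZ N N0; rewrite ler_norml.
have := mean_ln_Zsum_le b (@W0 N) Ws (natr_gt0 N0) (xN N0) u.
by rewrite -/(F N u); lra.
Qed.

Lemma mean_log_Z1_le u : 0 < u -> u <= 1 -> exists c, 0 <= c /\
  forall N, (0 < N)%N -> F N 1 <= N%:R * (h u / u) + c.
Proof.
move=> u0 u1; have [c [c0 cZ]] := ln_Zmean_asymp u0.
exists (u^-1 * c); split; first by rewrite mulr_ge0 ?invr_ge0// ltW.
move=> N N0; have [s [_ Ws]] := likely N0.
have := cZ N N0; rewrite ler_norml => /andP[_ cN].
have := mean_ln_Zsum1_le b (@W0 N) Ws (natr_gt0 N0) (xN N0) u0 u1.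
rewrite -/(F N 1) => /le_trans; apply.
have : u^-1 * ln (Zmean (@W N) N%:R b u) <= u^-1 * (N%:R * h u + c).
  by rewrite ler_pM2l ?invr_gt0//; lra.
by move=> /le_trans; apply; rewrite mulrDr lerD2r mulrC -mulrA.
Qed.

(** Serves to bound the product of the linear loss [L] and the exponentially small [eps] uniformly
    in N. *)
Lemma expR_linear_le (a e c : R) : 0 <= a -> 0 < e -> 0 <= c ->
  exists K, 0 <= K /\ forall N, (0 < N)%N ->
   (N%:R * a + c) * expR (- (N%:R * e)) <= K.
Proof.
move=> a0 e0 c0; exists (a / e + c); split.
  by rewrite addr_ge0 ?divr_ge0// ltW.
move=> N N0; have n0 := natr_gt0 N0; rewrite mulrDl lerD//.
  rewrite expRN ler_pdivrMr ?expR_gt0// mulrAC ler_pdivlMr//.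
  have := expR_ge1Dx (N%:R * e) => h1.
  have : a * (1 + N%:R * e) <= a * expR (N%:R * e) by rewrite ler_wpM2l.
  by lra.
by rewrite ler_piMr// -[leRHS]expR0 ler_expR oppr_le0 mulr_ge0// ltW.
Qed.

(** The gap p h(u) - h(pu) is the exponential rate at which the normalized p-th moment vanishes; the
    error sqrt N comes from the Gaussian of the single path kept. *)
Lemma mean_log_Z_high_temperature u p : 0 < u -> 1 < p -> p <= 2 ->
  h (p * u) < p * h u -> exists c, 0 <= c /\
  \forall N \near \oo, N%:R * h u - c * Num.sqrt N%:R <= F N u.
Proof.
move=> u0 p1 p2 hp; have p0 : 0 < p by lra.
have [c1 [c10 cZ1]] := ln_Zmean_asymp u0.
have [c2 [c20 cZ2]] := ln_Zmean_asymp (mulr_gt0 p0 u0).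
pose dl := p * h u - h (p * u); have dl0 : 0 < dl by rewrite subr_gt0.
have lnM0 : 0 <= ln M%:R :> R by rewrite ln_ge0// ler1n.
pose a := `|h u| + u * ln M%:R.
have a0 : 0 <= a by rewrite addr_ge0// mulr_ge0// ltW.
pose c3 := c2 + p * c1.
have [K [K0 KN]] := expR_linear_le a0 dl0 c10.
have ln40 : 0 <= ln 4 :> R by rewrite ln_ge0// ler1n.
exists (c1 + ln 4 + 4 * expR c3 * K + 4 * `|u * b|); split.
  by rewrite !addr_ge0// ?mulr_ge0// expR_ge0.
near=> N.
have N0 : (0 < N)%N by near: N; exact: nbhs_infty_gt.
have Nd : (c3 + ln 4) / dl <= N%:R by near: N; exact: nbhs_infty_ger.
have [s [lnWs Ws]] := likely N0.
have := cZ1 N N0; rewrite ler_norml; set z1 := Zmean _ _ _ u => /andP[l1 l2].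
have := cZ2 N N0; rewrite ler_norml; set z2 := Zmean _ _ _ (p * u) => /andP[l3
  l4].
have z10 : 0 < z1 by exact: (Zmean_gt0 _ _ Ws).
have z20 : 0 < z2 by exact: (Zmean_gt0 _ _ Ws).
have epsE : z2 / z1 `^ p <= expR (c3 - N%:R * dl).
  rewrite -(lnK (x := z2)) ?posrE// /powR gt_eqF// -expRB ler_expR /c3 /dl.
  have : p * (N%:R * h u - c1) <= p * ln z1 by rewrite ler_pM2l//; lra.
  by lra.
have eps4 : z2 / z1 `^ p <= 4^-1.
  apply: le_trans epsE _; rewrite -[leRHS](lnK (x := 4^-1)) ?posrE ?invr_gt0//.
  rewrite ler_expR lnV ?posrE//.
  by move: Nd; rewrite ler_pdivrMr//; lra.
pose L := N%:R * a + c1.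
have L0 : 0 <= L by rewrite addr_ge0// mulr_ge0.
have mL : ln z1 - u * ln (W s) <= L.
  have : u * (- (N%:R * ln M%:R)) <= u * ln (W s) by rewrite ler_pM2l.
  have : N%:R * h u <= N%:R * `|h u| by rewrite ler_wpM2l// ler_norm.
  by rewrite /L /a; lra.
have := mean_ln_Zsum_ge (@W0 N) Ws (natr_gt0 N0) (xN N0) p1 p2 eps4 L0 mL.
rewrite -/(F N u) -/z1 -/z2; apply: le_trans.
have Leps : 4 * L * (z2 / z1 `^ p) <= 4 * expR c3 * K.
  apply: (@le_trans _ _ (4 * L * expR (c3 - N%:R * dl))).
    by rewrite ler_wpM2l// mulr_ge0.
  have -> : 4 * L * expR (c3 - N%:R * dl) = 4 * expR c3 * (L * expR (- (N%:R *
    dl))).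
    by rewrite expRD; ring.
  by rewrite ler_wpM2l ?mulr_ge0 ?expR_ge0// KN.
have s1 := sqrt_natr_ge1 N0.
have : (c1 + ln 4 + 4 * expR c3 * K) * 1 <= (c1 + ln 4 + 4 * expR c3 * K) *
  Num.sqrt N%:R.
  by rewrite ler_wpM2l// !addr_ge0// ?mulr_ge0// expR_ge0.
by lra.
Unshelve. all: by end_near. Qed.

(** Convexity on u' < u < 1 read backwards: an upper bound at u' and a lower bound at u force a
    lower bound at 1. *)
Lemma mean_log_Z1_tangent u u' p V e : 0 < u' -> u' < u -> u < 1 ->
  1 < p -> p <= 2 -> h (p * u) < p * h u ->
  V <= h u' + (1 - u') * ((h u - h u') / (u - u')) -> 0 < e ->
  \forall N \near \oo, N%:R * (V - e) <= F N 1.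
Proof.
move=> u'0 uu' u1 p1 p2 hp VE e0; have u0 : 0 < u by lra.
have [c [c0 cN]] := mean_log_Z_high_temperature u0 p1 p2 hp.
have [c' [c'0 c'N]] := mean_log_Z_le u'0.
have u'1 : 0 < 1 - u' by lra.
(* k is the weight of 1 in u as a combination of u' and 1; the chord bound on V is rewritten without
   division, to match the convexity inequality. *)
have [k [k0 k1 uE hV]] : exists k, [/\ 0 < k, k <= 1, u = (1 - k) * u' + k &
    k * V <= h u - (1 - k) * h u'].
  have k0 : 0 < (u - u') / (1 - u') by rewrite divr_gt0//; lra.
  exists ((u - u') / (1 - u')); split => //.
  - by rewrite ler_pdivrMr//; lra.
  - by field; lra.
  - rewrite [leRHS](_ : _ = (u - u') / (1 - u') *
      (h u' + (1 - u') * ((h u - h u') / (u - u')))) ?ler_pM2l//.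
    by field; apply/andP; split; lra.
clear VE.
near=> N.
have N0 : (0 < N)%N by near: N; exact: nbhs_infty_gt.
have FN : N%:R * h u - c * Num.sqrt N%:R <= F N u by near: N; exact: cN.
have cc : (c + c') * Num.sqrt N%:R <= k * e * N%:R.
  by near: N; apply: sqrt_natr_sublinear; rewrite mulr_gt0.
have s1 := sqrt_natr_ge1 N0.
have [s [_ Ws]] := likely N0.
have := mean_ln_Zsum_convex b (@W0 N) Ws (natr_gt0 N0) (xN N0) u0 u'0 (ltW k0)
  k1 uE.
rewrite -/(F N u) -/(F N u') -/(F N 1); have := c'N N N0; move: FN.
move: (F N u) (F N u') (F N 1) => Fu Fu' F1 FN Fu'N Fc.
have F' : (1 - k) * Fu' <= (1 - k) * (N%:R * h u' + c').
  by rewrite ler_wpM2l//; lra.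
have c's : (1 - k) * c' <= c' * Num.sqrt N%:R.
  have : c' * 1 <= c' * Num.sqrt N%:R by rewrite ler_wpM2l.
  have : 0 <= k * c' by rewrite mulr_ge0// ltW.
  by lra.
have kV : N%:R * (k * V) <= N%:R * (h u - (1 - k) * h u').
  by rewrite ler_wpM2l.
rewrite -(ler_pM2l k0); lra.
Unshelve. all: by end_near. Qed.

Lemma mean_log_Z1_nonneg e : 0 < e -> \forall N \near \oo, N%:R * - e <= F N 1.
Proof.
move=> e0; near=> N.
have N0 : (0 < N)%N by near: N; exact: nbhs_infty_gt.
have [s [_ Ws]] := likely N0.
have := mean_ln_Zsum1_ge (@W0 N) Ws (natr_gt0 N0) b0 (xN N0)
  (sum_path_prob1 sP pi1 N0).
rewrite -/(F N 1); apply: le_trans.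
have : 4 * b * Num.sqrt N%:R <= e * N%:R.
  by near: N; exact: sqrt_natr_sublinear.
by lra.
Unshelve. all: by end_near. Qed.

End FreeEnergy.

(** * The variational formula *)

Section Entropy.
Context {R : realType} {M : nat}.
Variables (P : 'M[R]_M) (b : R).
Hypotheses (M0 : (0 < M)%N) (sP : stochastic P) (irrP : irreducible P).
Local Notation ell := (log_lambda P).
Local Notation h := (gauss_pressure ell b).

Lemma entropy_attained t0 rho :
  (forall t, ell t0 - t0 * rho <= ell t - t * rho) ->
  entropy P rho = (ell t0 - t0 * rho)%:E.
Proof.
move=> tmin; apply/le_anti/andP; split.
  by apply: ereal_inf_lbound; exists t0.
by apply: le_ereal_inf_tmp => _ [t _ <-]; rewrite lee_fin; exact: tmin.
Qed.

Lemma entropy_le rho r t : entropy P rho = r%:E -> r <= ell t - t * rho.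
Proof.
by move=> rE; rewrite -lee_fin -rE; apply: ereal_inf_lbound; exists t.
Qed.

(* Weak duality: [r - xi^2/2 >= 0] may be divided by [th <= 1]. *)
Lemma entropy2_le rho xi th : 0 < th -> th <= 1 ->
  (entropy2 P rho xi + (b * xi + rho)%:E <= (h th / th)%:E)%E.
Proof.
move=> th0 th1; rewrite /entropy2; case rE : (entropy P rho) => [r| |];
  last 2 first.
- by rewrite addNye leNye.
- by rewrite addNye leNye.
case: ifP => xir; last by rewrite addNye leNye.
rewrite -EFinD lee_fin ler_pdivlMr//.
have r1 := entropy_le 1 rE; rewrite log_lambda1// in r1.
have rth := entropy_le th rE.
have lth := log_lambda_ge0 M0 sP irrP th1.
have [r0|r0] := leP 0 r.
  have xi2 : xi ^+ 2 <= 2 * r.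
    rewrite -(@sqr_sqrtr _ (2 * r)) ?mulr_ge0// -[leLHS]real_normK ?num_real//.
    by rewrite lerXn2r ?nnegrE.
  have sq : 0 <= (xi - th * b) ^+ 2 by rewrite sqr_ge0.
  have sqE : (xi - th * b) ^+ 2 = xi ^+ 2 - 2 * (th * (b * xi)) + th ^+ 2 * b
    ^+ 2 by ring.
  rewrite /gauss_pressure; move: sq; rewrite sqE => sq.
  have : 0 <= (1 - th) * (r - xi ^+ 2 / 2) by rewrite mulr_ge0//; lra.
  by lra.
(* For r < 0 the square root is 0 by convention, so only xi = 0 survives; there r + rho <=
   [log_lambda P 1] = 0, while h(th) >= 0. *)
have xi0 : xi = 0.
  by move: xir; rewrite ler0_sqrtr ?normr_le0; [move/eqP|lra].
rewrite xi0 /gauss_pressure expr0n/= mulr0.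
have : (r + rho) * th <= 0 by rewrite mulr_le0_ge0//; lra.
have : 0 <= th ^+ 2 * b ^+ 2 by rewrite mulr_ge0 ?sqr_ge0.
by lra.
Qed.

End Entropy.

Theorem theorem3 (R : realType) (M : nat) (P : 'M[R]_M) (pi : 'rV[R]_M)
  (beta : R)
  (d : nat -> measure_display)
  (T : forall N : nat, measurableType (d N))
  (Pr : forall N : nat, probability (T N) R)
  (x : forall N : nat, N.-tuple 'I_M -> {RV (Pr N) >-> R}) :
  stochastic P -> irreducible P -> aperiodic P -> stationary pi P ->
  0 < beta ->
  (forall N : nat, (0 < N)%N -> iid_normal N%:R (x N)) ->
  exists phi : R,
    ((N%:R^-1)%:E *
     'E_(Pr N)[fun w => ln (partition_function pi P beta (fun s => x N s w))])%E
      @[N --> \oo] --> phi%:E /\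
    phi%:E = ereal_sup [set (entropy2 P q.1 q.2 + (beta * q.2 + q.1)%:E)%E
                       | q in [set: R * R]].
Proof.
move=> sP irrP _ [pi0 pi1 _] beta0 xN.
have M0 : (0 < M)%N.
  rewrite lt0n; apply/eqP => M00; move: pi1; rewrite big1 => [/esym/eqP|i _].
    by rewrite oner_eq0.
  by exfalso; move: i; rewrite M00 => -[].
have [V [Vup Vlo [t0 [rho [xi [tmin xile VE]]]]]] := gauss_pressure_duality
  beta0 (log_lambda_expansion M0 sP irrP) (log_lambda1 M0 sP irrP)
  (log_lambda_ge0 M0 sP irrP).
exists V; split; last first.
  (* The witness (rho, xi) attains V, and weak duality bounds every pair by values arbitrarily close
     to V. *)
  apply/le_anti/andP; split.
    apply: ereal_sup_ubound; exists (rho, xi) => //=.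
    by rewrite /entropy2 (entropy_attained tmin) xile -EFinD VE.
  apply: ge_ereal_sup => _ [q _ <-]; apply/lee_addgt0Pr => e e0.
  have [th [/andP[th0 th1] thV]] := Vup e e0.
  by rewrite (le_trans (entropy2_le beta M0 sP irrP q.1 q.2 th0 th1))// -EFinD
    lee_fin.
pose F N := mean_log_Z P pi beta x N 1.
have EF N : (0 < N)%N ->
    ('E_(Pr N)[fun w => ln (partition_function pi P beta (fun s => x N s w))] =
    (F N)%:E)%E.
  move=> N0; have [s [_ Ws]] := exists_likely_path M0 sP pi1 N0.
  have W0 (s' : N.-tuple 'I_M) : 0 <= path_prob pi P s'.
    by apply: path_prob_ge0 => //; case: sP.
  rewrite /F /mean_log_Z EFin_mean; last first.
    by apply: (summable_ln_Zsum _ W0 Ws _ (xN N N0)); rewrite ltr0n.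
  rewrite unlock; apply: eq_integral => w _; congr (ln _)%:E.
  apply: eq_bigr => s' _; rewrite powRr1// mulr_ge0 ?expR_ge0//.
apply/cvg_EFin.
  near=> N; rewrite EF ?fin_numM//; near: N; exact: nbhs_infty_gt.
apply/cvgrPdist_le => e e0.
(* In the upper bound and in the tangent case of the lower bound, half of the slack pays for the
   choice of exponents and half for the finite-N error. *)
have e2 : 0 < e / 2 by rewrite divr_gt0.
have lo : \forall N \near \oo, N%:R * (V - e) <= F N.
  case: Vlo => [V0|/(_ _ e2)[u' [u [p [/andP[u'0 uu'] u1 /andP[p1 p2] hp
    Ve]]]]].
    have := mean_log_Z1_nonneg M0 sP pi0 pi1 beta0 xN e0.
    apply: filterS => N; apply: le_trans; rewrite ler_wpM2l//; lra.
  have := mean_log_Z1_tangent M0 sP irrP pi0 pi1 xN u'0 uu' u1 p1 p2 hp Ve e2.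
  by apply: filterS => N; apply: le_trans; rewrite ler_wpM2l//; lra.
have [th [/andP[th0 th1] thV]] := Vup _ e2.
have [c [c0 cN]] := mean_log_Z1_le beta M0 sP irrP pi0 pi1 xN th0 th1.
near=> N.
have N0 : (0 < N)%N by near: N; exact: nbhs_infty_gt.
have n0 : 0 < N%:R :> R by rewrite ltr0n.
have ce : c / (e / 2) <= N%:R by near: N; exact: nbhs_infty_ger.
rewrite /comp EF// -EFinM/= ler_distlC mulrC.
apply/andP; split; first by rewrite ler_pdivlMr// mulrC; near: N.
rewrite ler_pdivrMr// (le_trans (cN N N0))//.
have : N%:R * (gauss_pressure (log_lambda P) beta th / th) <= N%:R * (V + e /
  2).
  by rewrite ler_wpM2l.
by move: ce; rewrite ler_pdivrMr//; lra.
Unshelve. all: by end_near. Qed.
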